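(* Let $r>0$ and let $V,M$ be as in the context, with in addition $\inf_VM>0$. Let $g^0\in L^\infty(\mathbb{R}\times V)$ satisfy $0\le g^0(x,v)\le M(v)$ for all $(x,v)\in\mathbb{R}\times V$, and let $g$ be the solution of the Cauchy problem $$\partial_tg+v\partial_xg=\big(M(v)\rho_g-g\big)+r\rho_g\big(M(v)-g\big)\ \text{ on }\mathbb{R}_+\times\mathbb{R}\times V,\qquad g(0,x,v)=g^0(x,v).$$ Let $c^*$ be the minimal speed of existence of travelling waves. Then: 1. if there exists $x_R$ such that $g^0(x,v)=0$ for all $x\ge x_R$ and $v\in V$, then for all $c>c^*$, $$(\forall v\in V)\quad\lim_{t\to+\infty}\Big(\sup_{x\ge ct}g(t,x,v)\Big)=0;$$ 2. if there exist $x_L$ and $\gamma\in(0,1)$ such that $g^0(x,v)\ge\gamma M(v)$ for all $x\le x_L$ and $v\in V$, then for all $c<c^*$, $$(\forall v\in V)\quad\lim_{t\to+\infty}\Big(\sup_{x\le ct}|M(v)-g(t,x,v)|\Big)=0.$$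
   Context: The set $V\subset\mathbb{R}$ is compact and symmetric ($V=-V$), $V=\operatorname{supp}M$, $M:V\to[0,\infty)$ is continuous with $\int_VM\,dv=1$, $\int_VvM\,dv=0$, $\int_Vv^2M\,dv<\infty$; $v_{\max}=\sup V$; $\rho_g=\int_Vg\,dv$. Solution: the unique solution of the Cauchy problem in the sense of distributions with $0\le g\le M$, identified with its mild form: for all $(t,x,v)$, $g(t,x,v)=g^0(x-vt,v)e^{-\int_0^ta(s)ds}+\int_0^te^{-\int_s^ta(\tau)d\tau}(1+r)M(v)\rho_g(s,x-v(t-s))\,ds$, where $a(\tau)=1+r\rho_g(\tau,x-(t-\tau)v)$. Minimal speed: $c^*\in(0,v_{\max})$ is the smallest $c\in[0,v_{\max})$ for which there is $\lambda\in(0,\frac1{v_{\max}-c}]$ with $(1+r)\int_V\frac{M(v)}{1+\lambda(c-v)}\,dv=1$. It is the speed such that travelling waves (continuous distributional solutions $f(x-ct,v)$ of the equation with $0\le f\le M$, $f(-\infty,v)=M(v)$, $f(+\infty,v)=0$) exist for all $c\in[c^*,v_{\max})$, and no positive ones exist for $c\in[0,c^* )$. *)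

(* Defs.v *)
From HB Require Import structures.
From mathcomp Require Import all_boot all_order all_algebra.
From mathcomp Require Import all_classical all_reals all_analysis.

Set Implicit Arguments.
Unset Strict Implicit.
Unset Printing Implicit Defensive.

Import Order.TTheory GRing.Theory Num.Theory.
Import numFieldNormedType.Exports.

Local Open Scope classical_set_scope.
Local Open Scope ring_scope.

(* Functions "on V" are represented by functions on all of [R]; only their
   values at points of [V] are ever used. *)

(* Support of the density [M] on [V], i.e. of the measure M(v) dv.  Since V is
   not assumed to be an interval this is the reading to use: the closure of
   [M != 0] would allow Lebesgue-null pieces of V, such as isolated points,
   which contribute to sup V but not to the dynamics. *)
Definition density_supp (R : realType) (V : set R) (M : R -> R) : set R :=
  [set v | forall e : R, 0 < e ->
    (0%E < \int[lebesgue_measure]_(w in V `&` ball v e) (M w)%:E)%E].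

Definition rho (R : realType) (V : set R) (g : R -> R -> R -> R) (t x : R) : R :=
  \int[lebesgue_measure]_(v in V) g t x v.

(* The rate a(tau) = 1 + r rho_g(tau, x - (t - tau) v) along the
   characteristic of velocity [v] that passes through [x] at time [t]. *)
Definition damping (R : realType) (r : R) (V : set R) (g : R -> R -> R -> R)
    (t x v tau : R) : R :=
  1 + r * rho V g tau (x - (t - tau) * v).

Definition mild_form (R : realType) (r : R) (V : set R) (M : R -> R)
    (g0 : R -> R -> R) (g : R -> R -> R -> R) : Prop :=
  forall t x v : R, 0 <= t -> V v ->
    g t x v =
      g0 (x - v * t) v *
        expR (- \int[lebesgue_measure]_(s in `[0, t]) damping r V g t x v s)
      + \int[lebesgue_measure]_(s in `[0, t])
          (expR (- \int[lebesgue_measure]_(tau in `[s, t])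
                     damping r V g t x v tau)
           * ((1 + r) * M v * rho V g s (x - v * (t - s)))).

(* Solution of
     d_t g + v d_x g = (M rho_g - g) + r rho_g (M - g),   g(0, ., .) = g0,
   with 0 <= g <= M, given by Duhamel's formula along characteristics; it is
   required to hold at every (t, x, v).  Joint measurability makes all the
   integrals above integrals of bounded measurable functions. *)
Definition cauchy_solution (R : realType) (r : R) (V : set R) (M : R -> R)
    (g0 : R -> R -> R) (g : R -> R -> R -> R) : Prop :=
  [/\ measurable_fun
        [set p : R * R * R | 0 <= p.1.1 /\ V p.2]
        (fun p : R * R * R => g p.1.1 p.1.2 p.2),
      forall t x v, 0 <= t -> V v -> 0 <= g t x v <= M v &
      mild_form r V M g0 g].

(* The integral is extended-real valued: for lambda = 1 / (sup V - c) the
   nonnegative integrand is singular at v = sup V and may fail to be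
   integrable. The value of the integrand at the point sup V is irrelevant. *)
Definition dispersion_speeds (R : realType) (r : R) (V : set R) (M : R -> R)
    : set R :=
  [set c | 0 <= c < sup V /\
    exists lambda : R,
      0 < lambda <= (sup V - c)^-1 /\
      ((1 + r)%:E *
        \int[lebesgue_measure]_(v in V) (M v / (1 + lambda * (c - v)))%:E
       = 1%E)%E].

Definition minimal_speed (R : realType) (r : R) (V : set R) (M : R -> R)
    (c : R) : Prop :=
  dispersion_speeds r V M c /\ lbound (dispersion_speeds r V M) c.

(* Main.v *)
Require Import Defs.
From mathcomp Require Import all_boot all_order all_algebra.
From mathcomp Require Import all_classical all_reals all_analysis.
From mathcomp Require Import measurable_realfun ring lra.

Import Order.TTheory GRing.Theory Num.Theory.
Import numFieldNormedType.Exports.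

Local Open Scope classical_set_scope.
Local Open Scope ring_scope.

(** The proof compares solutions along characteristics.  Put [k = 1 + r].
    Duhamel's formula with the variable damping [1 + r rho] can be rewritten
    with the constant damping [k] ([duhamel_change_damping], [mild_gain]); the
    source is then
      gain = r (1 - rho) g + (1 + r) M rho,
    which increases with [g] and with [rho] as long as [0 <= g <= M] and
    [0 <= rho <= 1].  A sub-solution of this integral equation that starts
    below [g] therefore remains below [g]: the possible excess after [n]
    Picard iterations is at most [M (C t)^n / n!] ([comparison]).

    First assertion.  Dropping the saturation term [- r rho g] leaves a linear
    equation, solved by [exp (- lam (x - cstar t)) F v] with
    [F v = (1 + r) M v / (1 + lam (cstar - v))]; the dispersion relation says
    that [F] has integral 1, so that [exp (- lam (x - cstar t))] is the density
    of this solution.  Hence [rho <= A exp (- lam (x - cstar t))]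
    ([rho_exp_bound]).  When [lam = 1 / (sup V - cstar)] the profile [F] is
    singular, but only at [sup V], which does not affect [rho]; the bound on
    [g] at every velocity is then recovered from the bound on [rho] at the
    price of a factor [t] ([g_exp_bound]).

    Second assertion.  Choose [c1] with [0 < c1 < cstar] and [c < c1].  In the
    frame of speed [c1], a particle of velocity [v] flying for a time [s] is
    displaced by [(v - c1) s].  Averaging over [v] with density [M], and over
    exponential flight times shorter than [S], gives a positive operator
    [jump V M c1 S] with bounded jumps.  Since [c1] is smaller than every speed
    solving the dispersion relation, there are [S] and [b < 1 + r] such that
    [b * jump (exp (lam z)) > 1] for all [lam >= 0]: otherwise a compactness
    argument ([common_tilt]) and the intermediate value theorem
    ([dispersion_root]) would produce a solution of the dispersion relation at
    speed [c1].  At the value of [lam] for which the tilted displacement is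
    centred, [exp (- lam y) (1 - y^2 / L^2)_+] is a sub-solution of
    [b * jump] for large [L] ([compact_subsolution]).  It is the density of a
    small compactly supported travelling sub-solution of speed [c1]; the room
    between [b] and [1 + r] absorbs the saturation term.  All its translates
    that start to the left of the initial front stay below [g], so
    [g >= eta M] for [x <= c1 t + X0] ([invasion_lower_bound]).  In that
    region the relative defect [u = 1 - g / M] satisfies
      u_t + v u_x + (1 + r rho) u = int M u dv   with  rho >= eta,
    hence decays like [exp (- delta t)], up to a boundary layer
    [2 exp (m (x - c1 t - X0))] that is negligible for [x <= c t]
    ([relaxation_lower_bound]). *)

Set Implicit Arguments.
Unset Strict Implicit.
Unset Printing Implicit Defensive.

(** * Integrals over intervals *)

Section IntervalIntegrals.
Variable R : realType.
Implicit Types (f g : R -> R) (a b t : R).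
Notation mu := (@lebesgue_measure R).

(** Cutting the interval into [n] pieces bounds the total increment by
    [C (b - a)^2 / n].  This is a substitute for a vanishing derivative that
    applies to integral equations with merely measurable coefficients. *)
Lemma const_of_quadratic_increments (D : R -> R) (C a b : R) : a <= b ->
  (forall x y, a <= x -> x <= y -> y <= b -> `|D y - D x| <= C * (y - x) ^+ 2) ->
  D b = D a.
Proof.
move=> ab H.
have C0 : 0 <= C * (b - a) ^+ 2.
  by apply: le_trans (H a b _ _ _).
apply/eqP; rewrite -subr_eq0 -normr_le0.
apply/ler_addgt0Pr => e e0; rewrite add0r.
(* [n.+1] is the number of pieces. *)
have [n ne] : exists n : nat, C * (b - a) ^+ 2 / n.+1%:R <= e.
  exists (Num.truncn (C * (b - a) ^+ 2 / e)).
  rewrite ler_pdivrMr ?ltr0Sn// [leRHS]mulrC -ler_pdivrMr//.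
  by apply: ltW; apply: truncnS_gt.
apply: le_trans ne.
pose x (i : nat) := a + (b - a) * (i%:R / n.+1%:R).
have step i : (i <= n)%N ->
    `|D (x i.+1) - D (x i)| <= C * (b - a) ^+ 2 / n.+1%:R ^+ 2.
  move=> ni.
  have n0 : (0 : R) < n.+1%:R by [].
  have -> : C * (b - a) ^+ 2 / n.+1%:R ^+ 2 = C * (x i.+1 - x i) ^+ 2.
    rewrite /x -(natr1 i); field.
    by rewrite addrC natr1 gt_eqF.
  apply: H.
  - by rewrite lerDl mulr_ge0 ?subr_ge0// divr_ge0.
  - by rewrite lerD2l ler_wpM2l ?subr_ge0// ler_pM2r ?invr_gt0// ler_nat.
  - rewrite /x -lerBrDl -[leRHS]mulr1 ler_wpM2l ?subr_ge0//.
    by rewrite ler_pdivrMr// mul1r ler_nat.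
have sum i : (i <= n.+1)%N ->
    `|D (x i) - D a| <= i%:R * (C * (b - a) ^+ 2 / n.+1%:R ^+ 2).
  elim: i => [|i IH] ni.
    by rewrite /x mul0r mulr0 addr0 subrr normr0 mul0r.
  rewrite -(subrK (D (x i)) (D (x i.+1))) -addrA.
  apply: le_trans (ler_normD _ _) _.
  rewrite -natr1 mulrDl mul1r [leRHS]addrC lerD//; first exact: step.
  by apply: IH; exact: ltnW.
have xb : x n.+1 = b by rewrite /x divff ?pnatr_eq0// mulr1 addrC subrK.
have := sum n.+1 (leqnn _).
rewrite xb => /le_trans; apply.
rewrite le_eqVlt; apply/orP; left; apply/eqP; field.
by rewrite addrC natr1 pnatr_eq0.
Qed.

Lemma itv_finite a b : (mu `[a, b] < +oo)%E.
Proof.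
rewrite lebesgue_measure_itv/=; case: ifP => _; last by rewrite ltry.
by rewrite -EFinB ltry.
Qed.

Lemma itv_integrable a b f (C : R) : measurable_fun `[a, b] f ->
  (forall x, a <= x <= b -> `|f x| <= C) ->
  mu.-integrable `[a, b] (EFin \o f).
Proof.
move=> mf fC; apply: measurable_bounded_integrable => //.
  exact: itv_finite.
exists C; split; first exact: num_real.
move=> y Cy x /=; rewrite in_itv/= => /fC h; exact: le_trans h (ltW Cy).
Qed.

Lemma continuous_itv_integrable a b f : continuous f ->
  mu.-integrable `[a, b] (EFin \o f).
Proof.
move=> cf; apply: continuous_compact_integrable; first exact: segment_compact.
exact: continuous_subspaceT.
Qed.

Lemma fine_itv a b : a <= b -> fine (mu `[a, b]) = b - a.
Proof.
rewrite lebesgue_measure_itv/= lte_fin le_eqVlt => /predU1P[->|->//].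
by rewrite ltxx subrr.
Qed.

Lemma Rint_cst a b (C : R) : a <= b ->
  \int[mu]_(s in `[a, b]) C = C * (b - a).
Proof. by move=> ab; rewrite Rintegral_cst// fine_itv. Qed.

Lemma Rint_bound a b f (C : R) : a <= b -> measurable_fun `[a, b] f ->
  (forall x, a <= x <= b -> `|f x| <= C) ->
  `|\int[mu]_(s in `[a, b]) f s| <= C * (b - a).
Proof.
move=> ab mf fC; have fi := itv_integrable mf fC.
apply: le_trans (le_normr_Rintegral _ fi) _ => //.
rewrite -Rint_cst//; apply: le_Rintegral => //.
- exact: integrable_norm fi.
- by apply: continuous_itv_integrable => x; exact: cvg_cst.
Qed.

Lemma Rint_split a b c f : a <= b -> b <= c ->
  mu.-integrable `[a, c] (EFin \o f) ->
  \int[mu]_(s in `[a, c]) f s =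
  \int[mu]_(s in `[a, b]) f s + \int[mu]_(s in `[b, c]) f s.
Proof.
move=> ab bc fi.
have := @Rintegral_itvB _ f (BLeft a) (BRight c) b fi.
rewrite !bnd_simp => /(_ ab bc).
rewrite Rintegral_itv_obnd_cbnd; last first.
  apply: integrableS fi => //.
  by apply: subset_itvr; rewrite bnd_simp.
by move=> <-; rewrite addrC subrK.
Qed.

Lemma expR_sub1_bound (x y : R) : `|x| <= y -> `|expR x - 1| <= y * expR y.
Proof.
move=> xy; have y0 : 0 <= y by apply: le_trans xy.
move: xy; rewrite ler_norml => /andP[xl xr].
rewrite ler_norml; apply/andP; split.
- have := expR_ge1Dx x. have := expR_ge1Dx y. nra.
- have := expR_ge1Dx (- x); rewrite expRN => h.
  have e0 := expR_gt0 x.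
  have : expR x * (1 - x) <= 1.
    by rewrite mulrC -ler_pdivlMr// div1r.
  have : expR x <= expR y by rewrite ler_expR.
  have := expR_gt0 y.
  have [x0|x0] := lerP 0 x; nra.
Qed.

Lemma expR_sub1x_bound (x y : R) : `|x| <= y ->
  `|expR x - 1 - x| <= y ^+ 2 * expR y.
Proof.
move=> xy; have y0 : 0 <= y by apply: le_trans xy.
have h0 : 0 <= expR x - 1 - x by have := expR_ge1Dx x; lra.
rewrite ger0_norm//.
have h : expR x - 1 - x <= x * (expR x - 1).
  have := expR_ge1Dx (- x); rewrite expRN => h.
  have e0 := expR_gt0 x.
  have : expR x * (1 - x) <= 1.
    by rewrite mulrC -ler_pdivlMr// div1r.
  nra.
apply: le_trans h _; apply: le_trans (ler_norm _) _.
rewrite normrM expr2 -mulrA; apply: ler_pM => //; exact: expR_sub1_bound.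
Qed.

Lemma expR_mulrn_cvg0 k : 0 < k -> expR (- (k * n.+1%:R)) @[n --> \oo] --> (0 : R).
Proof.
move=> k0.
have -> : (fun n : nat => expR (- (k * n.+1%:R))) = (fun n => expR (- k) ^+ n.+1).
  by apply/funext => n; rewrite -expRM_natr mulNr.
have h : (fun n => expR (- k) ^+ n) @ \oo --> (0 : R).
  apply: cvg_expr; rewrite ger0_norm ?expR_ge0//.
  by rewrite -expR0 ltr_expR oppr_lt0.
apply: (cvg_comp (fun n => n.+1) (fun n => expR (- k) ^+ n)); last exact: h.
by under eq_fun do rewrite -addn1; exact: cvg_addnr.
Qed.

Lemma measurable_inv : measurable_fun [set: R] (@GRing.inv R).
Proof.
rewrite -(setUv [set (0 : R)]); apply/measurable_funU.
- exact: measurable_set1.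
- by apply: measurableC; exact: measurable_set1.
split; first exact: measurable_fun_set1.
apply: open_continuous_measurable_fun.
  by rewrite openC; exact: closed_eq.
by move=> x; rewrite inE /= => /eqP x0; exact: inv_continuous.
Qed.

Lemma integrable_scale (D : set R) k f : measurable D ->
  mu.-integrable D (EFin \o f) -> mu.-integrable D (EFin \o (fun x => k * f x)).
Proof.
move=> mD fi; have := @integrableZl _ _ _ mu D mD k _ fi.
by apply: eq_integrable => // v _ /=; rewrite EFinM.
Qed.

Lemma integrable_add (D : set R) f g : measurable D ->
  mu.-integrable D (EFin \o f) -> mu.-integrable D (EFin \o g) ->
  mu.-integrable D (EFin \o (fun x => f x + g x)).
Proof.
move=> mD fi gi; have := @integrableD _ _ _ mu D mD _ _ fi gi.
by apply: eq_integrable => // v _ /=; rewrite EFinD.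
Qed.

Lemma integrable_mul_bounded (D : set R) f g (C : R) : measurable D ->
  mu.-integrable D (EFin \o f) -> measurable_fun D g ->
  (forall x, D x -> `|g x| <= C) ->
  mu.-integrable D (EFin \o (fun x => f x * g x)).
Proof.
move=> mD fi mg gC.
apply: (@le_integrable _ _ _ mu D mD (EFin \o (fun x => f x * g x))
  (EFin \o (fun x => C * `|f x|))).
- apply/measurable_EFinP; apply: measurable_funM => //.
  by apply/measurable_EFinP; exact: measurable_int fi.
- move=> x Dx /=; rewrite lee_fin normrM [leRHS]ger0_norm.
    by rewrite mulrC ler_wpM2r// gC.
  by rewrite mulr_ge0// (le_trans _ (gC x Dx)).
- apply: integrable_scale => //; exact: integrable_norm fi.
Qed.

Lemma integrable_le (D : set R) f g : measurable D -> measurable_fun D f ->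
  (forall x, D x -> `|f x| <= g x) ->
  mu.-integrable D (EFin \o g) -> mu.-integrable D (EFin \o f).
Proof.
move=> mD mf fg gi.
apply: (@le_integrable _ _ _ mu D mD (EFin \o f) (EFin \o g)) => //.
- exact/measurable_EFinP.
- by move=> v Vv /=; rewrite lee_fin (le_trans (fg v Vv))// ler_norm.
Qed.

Lemma EFin_Rintegral (D : set R) f : measurable D ->
  mu.-integrable D (EFin \o f) ->
  ((\int[mu]_(x in D) f x)%:E = \int[mu]_(x in D) (f x)%:E)%E.
Proof. by move=> mD fi; rewrite /Rintegral fineK//; exact: integrable_fin_num fi. Qed.

Lemma Rintegral_setD1 (D : set R) f a : measurable D ->
  mu.-integrable D (EFin \o f) ->
  \int[mu]_(x in D `\ a) f x = \int[mu]_(x in D) f x.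
Proof.
move=> mD fi; rewrite /Rintegral; congr fine; apply: integral_setD1.
  exact: measurableD.
have mf := measurable_int mu fi.
by apply: (measurable_funS mD _ mf); exact: subDsetl.
Qed.

(** The exceptional point accounts for profiles that are singular at the
    largest velocity. *)
Lemma le_Rintegral_off_point (D : set R) f g a : measurable D ->
  mu.-integrable D (EFin \o f) -> mu.-integrable D (EFin \o g) ->
  (forall x, D x -> x != a -> f x <= g x) ->
  \int[mu]_(x in D) f x <= \int[mu]_(x in D) g x.
Proof.
move=> mD fi gi fg.
rewrite -(Rintegral_setD1 a mD fi) -(Rintegral_setD1 a mD gi).
have mDa : measurable (D `\ a) by exact: measurableD.
apply: le_Rintegral => //.
- by apply: integrableS fi => //; exact: subDsetl.
- by apply: integrableS gi => //; exact: subDsetl.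
- by move=> x [Dx /eqP xa]; exact: fg.
Qed.

Lemma weight_integrable (k t C : R) f : measurable_fun `[0, t] f ->
  (forall s, 0 <= s <= t -> `|f s| <= C) ->
  mu.-integrable `[0, t] (EFin \o (fun s => expR (- (k * (t - s))) * f s)).
Proof.
move=> mf fC.
have me : measurable_fun `[0, t] (fun s => expR (- (k * (t - s)))).
  apply: measurable_funTS; apply: measurableT_comp => //.
  by apply: measurableT_comp => //; apply: measurable_funM => //;
    exact: measurable_funB.
apply: (@itv_integrable _ _ _ (expR (`|k| * t) * C)).
  exact: measurable_funM.
move=> s /andP[s0 st]; rewrite normrM; apply: ler_pM => //; last by rewrite fC ?s0.
rewrite ger0_norm ?expR_ge0// ler_expR.
apply: le_trans (ler_norm _) _; rewrite normrN normrM ler_wpM2l//.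
by rewrite ger0_norm ?subr_ge0// gerBl.
Qed.

Lemma is_derive_continuous f s (d : R) : is_derive s (1 : R) f d -> {for s, continuous f}.
Proof.
by move=> [fd _]; apply: differentiable_continuous; apply/derivable1_diffP.
Qed.

Lemma Rint_derive_itv f (df : R -> R) a b : a <= b ->
  (forall s, a <= s <= b -> is_derive s (1 : R) f (df s)) ->
  (forall s, a <= s <= b -> {for s, continuous df}) ->
  \int[mu]_(s in `[a, b]) df s = f b - f a.
Proof.
move=> + fd cdf; rewrite le_eqVlt => /predU1P[eqab|ab].
  by rewrite eqab set_itv1 Rintegral_set1 subrr.
have cf s : a <= s <= b -> {for s, continuous f}.
  by move=> /fd; exact: is_derive_continuous.
rewrite /Rintegral (@continuous_FTC2 _ df f a b ab)//.
- apply: continuous_in_subspaceT => s; rewrite inE /= in_itv/=.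
  exact: cdf.
- split.
  + by move=> s; rewrite in_itv/= => /andP[s1 s2]; have [] := fd s;
      rewrite ?(ltW s1) ?(ltW s2).
  + by apply: cvg_at_right_filter; apply: cf; rewrite lexx ltW.
  + by apply: cvg_at_left_filter; apply: cf; rewrite lexx ltW.
- move=> s; rewrite in_itv/= => /andP[s1 s2]; rewrite derive1E.
  by have [|_ ->] := fd s; rewrite ?(ltW s1) ?(ltW s2).
Qed.

Lemma power_fact_cvg0 (C t : R) : 0 <= C -> 0 <= t ->
  (C * t) ^+ n / n`!%:R @[n --> \oo] --> (0 : R).
Proof.
move=> C0 t0.
have := @is_cvg_series_exp_coeff _ (C * t).
exact: cvg_series_cvg_0.
Qed.

Lemma power_fact_continuous (C : R) n :
  continuous (fun s : R => C * ((C * s) ^+ n / n`!%:R)).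
Proof.
move=> s; apply: cvgM; first exact: cvg_cst.
apply: cvgM; last exact: cvg_cst.
apply: (@continuous_comp _ _ _ (fun x : R => C * x) (fun y : R => y ^+ n)).
  by apply: cvgM; [exact: cvg_cst|exact: cvg_id].
exact: exprn_continuous.
Qed.

(** The bounds [(C t)^n / n!] reproduce themselves in a Picard iteration. *)
Lemma power_integral (C t : R) n : 0 <= t ->
  \int[mu]_(s in `[0, t]) (C * ((C * s) ^+ n / n`!%:R))
   = (C * t) ^+ n.+1 / n.+1`!%:R.
Proof.
move=> t0.
have hd x : is_derive x (1 : R) (fun s : R => (C * s) ^+ n.+1 / n.+1`!%:R)
     (C * ((C * x) ^+ n / n`!%:R)).
  have -> : (fun s : R => (C * s) ^+ n.+1 / n.+1`!%:R) =
            (C ^+ n.+1 / n.+1`!%:R) \*: ((@id R) ^+ n.+1).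
    apply/funext => s; rewrite fctE /=.
    by rewrite /GRing.scale /= exprMn mulrAC.
  apply: is_derive_eq; rewrite /GRing.scale /= mulr1.
  rewrite factS natrM exprMn exprS.
  field.
  by rewrite addrC natr1 !pnatr_eq0 -lt0n fact_gt0.
rewrite (Rint_derive_itv t0 (fun s _ => hd s)); last first.
  by move=> s _; exact: power_fact_continuous.
by rewrite mulr0 expr0n mul0r subr0.
Qed.

Lemma is_derive_expR_affine (a b x : R) :
  is_derive x (1 : R) (fun s => expR (a + b * s)) (b * expR (a + b * x)).
Proof.
have -> : (fun s => expR (a + b * s)) = expR \o ((cst a) + b \*: (@id R)).
  by apply/funext => s.
by apply: is_derive_eq; rewrite add0r /GRing.scale /= mulr1 mulrC.
Qed.

Lemma continuous_expR_affine (a b : R) : continuous (fun s => expR (a + b * s)).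
Proof.
move=> x; apply: differentiable_continuous; apply/derivable1_diffP.
by have [] := is_derive_expR_affine a b x.
Qed.

Lemma Rint_expR_affine (a b t : R) : 0 <= t ->
  \int[mu]_(s in `[0, t]) (b * expR (a + b * s)) = expR (a + b * t) - expR a.
Proof.
move=> t0.
rewrite (Rint_derive_itv t0 (fun s _ => is_derive_expR_affine a b s)).
  by rewrite mulr0 addr0.
by move=> x _; apply: cvgM; [exact: cvg_cst|exact: continuous_expR_affine].
Qed.

Lemma continuous_expRZ (a : R) : continuous (fun s : R => expR (a * s)).
Proof.
move=> x; apply: (@continuous_comp _ _ _ (fun s : R => a * s) expR).
  by apply: cvgM; [exact: cvg_cst|exact: cvg_id].
exact: continuous_expR.
Qed.

Lemma continuousMf f g : continuous f -> continuous g -> continuous (fun x : R => f x * g x).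
Proof. by move=> cf cg x; apply: cvgM; [exact: cf|exact: cg]. Qed.

Lemma continuousDf f g : continuous f -> continuous g -> continuous (fun x : R => f x + g x).
Proof. by move=> cf cg x; apply: cvgD; [exact: cf|exact: cg]. Qed.

Lemma continuous_cstf (k : R) : continuous (fun _ : R => k).
Proof. by move=> x; exact: cvg_cst. Qed.

Lemma continuous_idf : continuous (fun x : R => x).
Proof. by move=> x; exact: cvg_id. Qed.

Lemma continuousNf f : continuous f -> continuous (fun x : R => - f x).
Proof. by move=> cf x; apply: cvgN; exact: cf. Qed.

End IntervalIntegrals.

(** * Differentiation along characteristics *)

Section Transport.
Variable R : realType.
Implicit Types (f P dP src : R -> R) (a b s t S k : R).
Notation mu := (@lebesgue_measure R).

(** A differential inequality along a characteristic in Duhamel form: integrate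
    the derivative of [exp (- k (t - s)) * P s]. *)
Lemma le_duhamel k t P dP src : 0 <= t ->
  (forall s, 0 <= s <= t -> is_derive s (1 : R) P (dP s)) ->
  (forall s, 0 <= s <= t -> {for s, continuous dP}) ->
  mu.-integrable `[0, t] (EFin \o (fun s => expR (- (k * (t - s))) * src s)) ->
  (forall s, 0 <= s <= t -> k * P s + dP s <= src s) ->
  P t <= expR (- (k * t)) * P 0
    + \int[mu]_(s in `[0, t]) (expR (- (k * (t - s))) * src s).
Proof.
move=> t0 Pd cdP isrc le.
pose E s := expR (- (k * t) + k * s).
have EE s : expR (- (k * (t - s))) = E s by rewrite /E; congr expR; ring.
pose dQ s := E s * (k * P s + dP s).
have Qd s : 0 <= s <= t -> is_derive s (1 : R) (fun s => E s * P s) (dQ s).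
  move=> st; have dE := is_derive_expR_affine (- (k * t)) k s.
  have h := @is_deriveM _ _ E P s 1 _ _ dE (Pd s st).
  apply: is_derive_eq h _.
  by rewrite /dQ /E /GRing.scale /=; ring.
have cQ s : 0 <= s <= t -> {for s, continuous dQ}.
  move=> st; apply: cvgM; first exact: continuous_expR_affine.
  apply: cvgD; last exact: cdP.
  by apply: cvgM; [exact: cvg_cst|exact: is_derive_continuous (Pd s st)].
have H := Rint_derive_itv t0 Qd cQ.
have -> : P t = expR (- (k * t)) * P 0 + (E t * P t - E 0 * P 0).
  by rewrite /E mulr0 addr0 addNr expR0 mul1r addrC subrK.
rewrite lerD2l -H; apply: le_Rintegral => //.
  apply: continuous_compact_integrable; first exact: segment_compact.
  apply: continuous_in_subspaceT => s; rewrite inE /= in_itv/=.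
  exact: cQ.
move=> s; rewrite /= in_itv/= => st.
by rewrite EE /dQ ler_pM2l ?expR_gt0// le.
Qed.

(** An exponential memory of the input [f] obeys [h' = f - h]; cutting it at
    age [S] removes what reaches that age, at rate [exp (- S) * f (s - S)].  The
    lower bound on [s] provides one base point for the primitive of
    [exp u * f u] at all the arguments involved. *)
Lemma cut_memory_derive f S s : continuous f -> 0 <= S -> -1 < s ->
  let h u := \int[mu]_(y in `[0, S]) (expR (- y) * f (u - y)) in
  is_derive s (1 : R) h (f s - expR (- S) * f (s - S) - h s).
Proof.
move=> cf S0 s1 h.
pose a := - S - 1.
pose G u := expR u * f u.
have cG : continuous G by apply: continuousMf => //; exact: continuous_expR.
pose Psi u := \int[mu]_(y in `[a, u]) G y.
have dPsi u : a < u -> is_derive u (1 : R) Psi (G u).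
  move=> au; have u1 : u < u + 1 by rewrite ltrDl.
  have iG : mu.-integrable `[a, u + 1] (EFin \o G) by exact: continuous_itv_integrable.
  have [d1 d2] := continuous_FTC1_closed u1 iG au (cG u).
  by split; [exact: d1|rewrite -derive1E; exact: d2].
have hE u : -1 < u -> h u = expR (- u) * (Psi u - Psi (u - S)).
  move=> u1.
  have dN y : 0 <= y <= S -> is_derive y (1 : R) (fun y => - Psi (u - y)) (G (u - y)).
    move=> /andP[y0 yS].
    have d1 : is_derive (u - y) (1 : R) Psi (G (u - y)).
      by apply: dPsi; rewrite /a; lra.
    have d2 : is_derive y (1 : R) (fun y => u - y) (-1).
      have -> : (fun y : R => u - y) = (cst u) - (@id R) by apply/funext.
      by apply: is_derive_eq; rewrite sub0r.
    have d3 := @is_derive1_comp R Psi (fun y => u - y) y _ _ d1 d2.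
    have d4 := is_deriveN d3.
    apply: is_derive_eq d4 _.
    by rewrite mulrN1 opprK.
  have cN y : 0 <= y <= S -> {for y, continuous (fun y => G (u - y))}.
    move=> _; apply: (@continuous_comp _ _ _ (fun y : R => u - y) G); last exact: cG.
    by apply: cvgB; [exact: cvg_cst|exact: cvg_id].
  have := Rint_derive_itv S0 dN cN.
  rewrite subr0 opprK addrC => <-; rewrite -RintegralZl//; last first.
    apply: continuous_itv_integrable => y.
    apply: (@continuous_comp _ _ _ (fun y : R => u - y) G); last exact: cG.
    by apply: cvgB; [exact: cvg_cst|exact: cvg_id].
  apply: eq_Rintegral => y _; rewrite /G mulrA -expRD.
  by congr (expR _ * _); ring.
have dS : is_derive s (1 : R) (fun u => Psi (u - S)) (G (s - S)).
  have d1 : is_derive (s - S) (1 : R) Psi (G (s - S)).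
    by apply: dPsi; rewrite /a; lra.
  have d2 : is_derive s (1 : R) (fun u => u - S) 1.
    have -> : (fun u : R => u - S) = (@id R) - (cst S) by apply/funext.
    by apply: is_derive_eq; rewrite subr0.
  have d3 := @is_derive1_comp R Psi (fun u => u - S) s _ _ d1 d2.
  by apply: is_derive_eq d3 _; rewrite mulr1.
have ds : is_derive s (1 : R) Psi (G s) by apply: dPsi; rewrite /a; lra.
have dE : is_derive s (1 : R) (fun u => expR (- u)) (- expR (- s)).
  have := is_derive_expR_affine 0 (-1) s.
  rewrite add0r !mulN1r.
  by have -> : (fun u : R => expR (0 + -1 * u)) = (fun u => expR (- u))
    by apply/funext => u; rewrite add0r mulN1r.
have dk := @is_deriveM _ _ _ _ s 1 _ _ dE (is_deriveB ds dS).
apply: (@near_eq_is_derive _ _ _ (fun u => expR (- u) * (Psi u - Psi (u - S)))).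
  near=> u; rewrite hE//; near: u; exact: lt_nbhsr.
apply: is_derive_eq dk _.
rewrite (hE s s1) /GRing.scale /= /G !fctE.
have -> : expR (s - S) = expR s * expR (- S) by rewrite expRD.
have e1 : expR (- s) * expR s = 1 by rewrite -expRD addNr expR0.
transitivity ((expR (- s) * expR s) * (f s - expR (- S) * f (s - S)) -
  expR (- s) * (Psi s - Psi (s - S))); first by ring.
by rewrite e1 mul1r.
Unshelve. all: by end_near. Qed.

End Transport.

(** * Duhamel's formula with measurable damping *)

Section Duhamel.
Variable R : realType.
Notation mu := (@lebesgue_measure R).

Lemma itv_measurableS (T x y : R) (f : R -> R) : 0 <= x -> y <= T ->
  measurable_fun `[0, T] f -> measurable_fun `[x, y] f.
Proof.
move=> x0 yT; apply: measurable_funS => //.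
by apply: subset_itv; rewrite bnd_simp.
Qed.

Lemma primitive_diff (T A : R) (a : R -> R) (x y : R) :
  measurable_fun `[0, T] a -> (forall s, 0 <= s <= T -> `|a s| <= A) ->
  0 <= x -> x <= y -> y <= T ->
  \int[mu]_(s in `[0, y]) a s - \int[mu]_(s in `[0, x]) a s
    = \int[mu]_(s in `[x, y]) a s.
Proof.
move=> ma aA x0 xy yT.
rewrite (@Rint_split _ 0 x y)//; first by rewrite addrC addrA addNr add0r.
apply: (@itv_integrable _ _ _ _ A).
  exact: itv_measurableS ma.
by move=> s /andP[s0 sy]; apply: aA; rewrite s0 (le_trans sy).
Qed.

Lemma measurable_primitive (T A : R) (a : R -> R) :
  measurable_fun `[0, T] a -> (forall s, 0 <= s <= T -> `|a s| <= A) ->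
  measurable_fun `[0, T] (fun t => \int[mu]_(s in `[0, t]) a s).
Proof.
move=> ma aA; have [T0|T0] := lerP 0 T; last first.
  by rewrite set_itv_ge ?bnd_simp -?ltNge//; exact: measurable_fun_set0.
apply: subspace_continuous_measurable_fun => //.
apply: parameterized_integral_continuous => //.
exact: itv_integrable aA.
Qed.

(** The primitive [I] of a measurable damping is only Lipschitz, so the product
    [exp (- I t) * W t] is not differentiated: its increments are compared with
    those of the right-hand side, up to a quadratic error. *)
Lemma duhamel_integral_equation (T A B K : R) (a b G : R -> R) : 0 <= T ->
  measurable_fun `[0, T] a -> (forall s, 0 <= s <= T -> `|a s| <= A) ->
  measurable_fun `[0, T] b -> (forall s, 0 <= s <= T -> `|b s| <= B) ->
  measurable_fun `[0, T] G -> (forall s, 0 <= s <= T -> `|G s| <= K) ->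
  (forall t, 0 <= t <= T ->
    G t = G 0 * expR (- \int[mu]_(s in `[0, t]) a s)
      + \int[mu]_(s in `[0, t]) (expR (- \int[mu]_(u in `[s, t]) a u) * b s)) ->
  G T = G 0 + \int[mu]_(s in `[0, T]) (b s - a s * G s).
Proof.
move=> T0 ma aA mb bB mG GK mild.
have T0T : 0 <= T <= T by rewrite T0 lexx.
have A0 : 0 <= A by apply: le_trans (aA T T0T).
have B0 : 0 <= B by apply: le_trans (bB T T0T).
have K0 : 0 <= K by apply: le_trans (GK T T0T).
pose I t := \int[mu]_(s in `[0, t]) a s.
have mI : measurable_fun `[0, T] I by exact: measurable_primitive aA.
have IB x y : 0 <= x -> x <= y -> y <= T ->
   I y - I x = \int[mu]_(s in `[x, y]) a s.
  by move=> *; exact: primitive_diff aA _ _ _.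
have IL x y : 0 <= x -> x <= y -> y <= T -> `|I y - I x| <= A * (y - x).
  move=> x0 xy yT; rewrite IB//; apply: Rint_bound => //.
    exact: itv_measurableS ma.
  by move=> s /andP[xs sy]; apply: aA; rewrite (le_trans x0 xs) (le_trans sy).
have I0 : I 0 = 0 by rewrite /I set_itv1 Rintegral_set1.
have {}mild t : 0 <= t <= T -> G t = G 0 * expR (- I t)
    + \int[mu]_(s in `[0, t]) (expR (- (I t - I s)) * b s).
  move=> t0T; rewrite (mild t t0T); congr (_ + _).
  move: t0T => /andP[_ tT].
  apply: eq_Rintegral => s; rewrite inE/= in_itv/= => /andP[s0 st].
  by rewrite (IB s t s0 st tT).
clearbody I.
pose f s := expR (I s) * b s.
have mf : measurable_fun `[0, T] f.
  by apply: measurable_funM => //; exact: measurableT_comp.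
pose E := expR (A * T).
have E0 : 0 < E by exact: expR_gt0.
have exp1 x y : 0 <= x -> x <= y -> y <= T ->
    `|expR (I x - I y) - 1| <= A * (y - x) * E.
  move=> x0 xy yT.
  have h : `|I x - I y| <= A * (y - x) by rewrite distrC; exact: IL.
  apply: le_trans (expR_sub1_bound h) _.
  by rewrite ler_wpM2l ?mulr_ge0 ?subr_ge0// ler_expR ler_wpM2l//; lra.
have fI s : 0 <= s <= T -> `|f s| <= E * B.
  move=> /andP[s0 sT]; rewrite /f normrM ler_pM//; last by rewrite bB// s0.
  rewrite ger0_norm ?expR_ge0// ler_expR.
  have := IL 0 s (lexx _) s0 sT.
  rewrite I0 !subr0 => /ler_normlW/le_trans; apply.
  by rewrite ler_wpM2l.
pose W t := G 0 + \int[mu]_(s in `[0, t]) f s.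
have GW t : 0 <= t <= T -> G t = expR (- I t) * W t.
  move=> t0T; rewrite (mild t t0T) /W mulrDr mulrC; congr (_ + _).
  move: t0T => /andP[t0 tT].
  rewrite -RintegralZl; [|by []|].
    apply: eq_Rintegral => s _.
    by rewrite /f mulrA -expRD; congr (expR _ * _); ring.
  apply: (@itv_integrable _ _ _ _ (E * B)); first exact: itv_measurableS mf.
  by move=> s /andP[s0 st]; apply: fI; rewrite s0 (le_trans st).
have WB x y : 0 <= x -> x <= y -> y <= T ->
   W y - W x = \int[mu]_(s in `[x, y]) f s.
  move=> x0 xy yT; rewrite /W opprD addrACA subrr add0r.
  exact: primitive_diff fI _ _ _.
clearbody W.
have mh : measurable_fun `[0, T] (fun s => b s - a s * G s).
  by apply: measurable_funB => //; exact: measurable_funM.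
have hI s : 0 <= s <= T -> `|b s - a s * G s| <= B + A * K.
  move=> s0T; apply: le_trans (ler_normB _ _) _.
  by rewrite normrM lerD ?bB// ler_pM// ?aA// GK.
have Ginc x y : 0 <= x -> x <= y -> y <= T ->
   G y - G x = \int[mu]_(s in `[x, y]) (expR (I s - I y) * b s)
     + (expR (I x - I y) - 1) * G x.
  move=> x0 xy yT.
  have y0 : 0 <= y by exact: le_trans xy.
  have xT : x <= T by exact: le_trans yT.
  have x0T : 0 <= x <= T by rewrite x0.
  have y0T : 0 <= y <= T by rewrite y0.
  rewrite (GW x x0T) (GW y y0T).
  have -> : W y = W x + (W y - W x) by rewrite addrC subrK.
  have if_ : mu.-integrable `[x, y] (EFin \o f).
    apply: (@itv_integrable _ _ _ _ (E * B)); first exact: itv_measurableS mf.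
    by move=> s /andP[s0 st]; apply: fI; rewrite (le_trans x0)// (le_trans st).
  rewrite (WB x y x0 xy yT) mulrDr -RintegralZl; [|by []|exact: if_].
  rewrite mulrBl mul1r mulrA -expRD.
  have -> : I x - I y - I x = - I y by lra.
  have -> : \int[mu]_(s in `[x, y]) (expR (- I y) * f s) =
     \int[mu]_(s in `[x, y]) (expR (I s - I y) * b s).
    apply: eq_Rintegral => s _.
    by rewrite /f mulrA -expRD; congr (expR _ * _); lra.
  lra.
have mexp y : measurable_fun `[0, T] (fun s => expR (I s - I y)).
  by apply: measurableT_comp => //; exact: measurable_funB.
have GL x y : 0 <= x -> x <= y -> y <= T ->
   `|G y - G x| <= (E * B + A * E * K) * (y - x).
  move=> x0 xy yT; rewrite Ginc//; apply: le_trans (ler_normD _ _) _.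
  rewrite [leRHS]mulrDl lerD//.
    apply: Rint_bound => //.
      by apply: itv_measurableS (measurable_funM (mexp y) mb).
    move=> s /andP[xs sy]; rewrite normrM ler_pM//.
      rewrite ger0_norm ?expR_ge0// ler_expR.
      have s0 : 0 <= s by exact: le_trans xs.
      have := IL s y s0 sy yT; rewrite distrC => /ler_normlW/le_trans; apply.
      by rewrite ler_wpM2l//; lra.
    by apply: bB; rewrite (le_trans x0)// (le_trans sy).
  rewrite normrM.
  have -> : A * E * K * (y - x) = A * (y - x) * E * K by ring.
  apply: ler_pM => //; first exact: exp1.
  by apply: GK; rewrite x0 (le_trans xy).
pose D t := G t - \int[mu]_(s in `[0, t]) (b s - a s * G s).
suff : D T = D 0.
  rewrite /D set_itv1 Rintegral_set1 subr0 => <-.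
  by rewrite subrK.
apply: (@const_of_quadratic_increments _ D
  (A * E * B + A * (E * B + A * E * K) + A ^+ 2 * E * K)) => // x y x0 xy yT.
have y0 : 0 <= y by exact: le_trans xy.
have xT : x <= T by exact: le_trans yT.
have hxy := @primitive_diff T _ _ x y mh hI x0 xy yT.
have ixy (h : R -> R) (C : R) : measurable_fun `[0, T] h ->
    (forall s, 0 <= s <= T -> `|h s| <= C) ->
    mu.-integrable `[x, y] (EFin \o h).
  move=> mh' hC; apply: (@itv_integrable _ _ _ _ C).
    exact: itv_measurableS mh'.
  by move=> s /andP[xs sy]; apply: hC; rewrite (le_trans x0)// (le_trans sy).
have ia := ixy _ _ ma aA.
have ib := ixy _ _ mb bB.
have maG : measurable_fun `[0, T] (fun s => a s * G s) by exact: measurable_funM.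
have iaG : mu.-integrable `[x, y] (EFin \o (fun s => a s * G s)).
  by apply: (ixy _ (A * K)) => // s s0T; rewrite normrM ler_pM// ?aA// GK.
have meb : measurable_fun `[x, y] (fun s => expR (I s - I y) * b s).
  by apply: itv_measurableS (measurable_funM (mexp y) mb).
have ieb : mu.-integrable `[x, y] (EFin \o (fun s => expR (I s - I y) * b s)).
  apply: (@itv_integrable _ _ _ _ (E * B)) => //.
  move=> s /andP[xs sy]; rewrite normrM ler_pM//.
    rewrite ger0_norm ?expR_ge0// ler_expR.
    have s0 : 0 <= s by exact: le_trans xs.
    have := IL s y s0 sy yT; rewrite distrC => /ler_normlW/le_trans; apply.
    by rewrite ler_wpM2l//; lra.
  by apply: bB; rewrite (le_trans x0)// (le_trans sy).
have -> : D y - D x = \int[mu]_(s in `[x, y]) (expR (I s - I y) * b s - b s)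
    + \int[mu]_(s in `[x, y]) (a s * G s - a s * G x)
    + (expR (I x - I y) - 1 - (I x - I y)) * G x.
  rewrite RintegralB// RintegralB//; last first.
    apply: (ixy _ (A * K)); first exact: measurable_funM.
    by move=> s sT; rewrite normrM ler_pM// ?aA// GK// x0.
  have -> : D y - D x = (G y - G x) -
     (\int[mu]_(s in `[0, y]) (b s - a s * G s) -
      \int[mu]_(s in `[0, x]) (b s - a s * G s)) by rewrite /D; lra.
  rewrite hxy RintegralB// Ginc//.
  have -> : \int[mu]_(s in `[x, y]) (a s * G x) = (I y - I x) * G x.
    by rewrite IB//; apply: RintegralZr.
  ring.
apply: le_trans (ler_normD _ _) _; rewrite [leRHS]mulrDl lerD//; last first.
  rewrite normrM.
  have -> : A ^+ 2 * E * K * (y - x) ^+ 2 = (A * (y - x)) ^+ 2 * E * K by ring.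
  apply: ler_pM => //; last by rewrite GK// x0.
  have h : `|I x - I y| <= A * (y - x) by rewrite distrC; exact: IL.
  apply: le_trans (expR_sub1x_bound h) _.
  by rewrite ler_wpM2l ?exprn_ge0 ?mulr_ge0 ?subr_ge0// ler_expR ler_wpM2l//; lra.
apply: le_trans (ler_normD _ _) _; rewrite [leRHS]mulrDl lerD// expr2 mulrA.
- apply: Rint_bound => //.
    by apply: measurable_funB => //; exact: itv_measurableS mb.
  move=> s /andP[xs sy].
  have s0 : 0 <= s by exact: le_trans xs.
  rewrite -[X in _ - X]mul1r -mulrBl normrM.
  have -> : A * E * B * (y - x) = A * (y - x) * E * B by ring.
  apply: ler_pM => //; last by rewrite bB// s0 (le_trans sy).
  apply: le_trans (exp1 _ _ s0 sy yT) _.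
  by rewrite ler_wpM2r ?(ltW E0)// ler_wpM2l//; lra.
- apply: Rint_bound => //.
    apply: measurable_funB; first exact: itv_measurableS maG.
    by apply: measurable_funM => //; exact: itv_measurableS ma.
  move=> s /andP[xs sy].
  have s0 : 0 <= s by exact: le_trans xs.
  have sT : s <= T by exact: le_trans sy _.
  rewrite -mulrBr normrM -mulrA; apply: ler_pM => //; first by rewrite aA ?s0.
  apply: le_trans (GL _ _ x0 xs sT) _.
  by rewrite ler_wpM2l ?addr_ge0 ?mulr_ge0 ?(ltW E0)//; lra.
Qed.

(** Multiplying [G] by [exp (k s)] replaces the damping [a] by [a - k]. *)
Lemma duhamel_change_damping (k T A B K : R) (a b G : R -> R) : 0 <= T ->
  measurable_fun `[0, T] a -> (forall s, 0 <= s <= T -> `|a s| <= A) ->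
  measurable_fun `[0, T] b -> (forall s, 0 <= s <= T -> `|b s| <= B) ->
  measurable_fun `[0, T] G -> (forall s, 0 <= s <= T -> `|G s| <= K) ->
  (forall t, 0 <= t <= T ->
    G t = G 0 * expR (- \int[mu]_(s in `[0, t]) a s)
      + \int[mu]_(s in `[0, t]) (expR (- \int[mu]_(u in `[s, t]) a u) * b s)) ->
  G T = expR (- (k * T)) * G 0
    + \int[mu]_(s in `[0, T])
        (expR (- (k * (T - s))) * ((k - a s) * G s + b s)).
Proof.
move=> T0 ma aA mb bB mG GK mild.
have kE s : 0 <= s <= T -> `|expR (k * s)| <= expR (`|k| * T).
  move=> /andP[s0 sT]; rewrite ger0_norm ?expR_ge0// ler_expR.
  by apply: le_trans (ler_norm _) _; rewrite normrM ler_pM// ger0_norm.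
have mk (D : set R) : measurable_fun D (fun s => expR (k * s)).
  by apply: measurableT_comp => //; exact: measurable_funM.
have iek (C : R) (h : R -> R) x y : 0 <= x -> y <= T -> measurable_fun `[0, T] h ->
    (forall s, 0 <= s <= T -> `|h s| <= C) ->
    mu.-integrable `[x, y] (EFin \o h).
  move=> x0 yT mh hC; apply: (@itv_integrable _ _ _ _ C).
    exact: itv_measurableS mh.
  by move=> s /andP[xs sy]; apply: hC; rewrite (le_trans x0)// (le_trans sy).
have akI x y : 0 <= x -> x <= y -> y <= T ->
    \int[mu]_(s in `[x, y]) (a s - k) = \int[mu]_(s in `[x, y]) a s - k * (y - x).
  move=> x0 xy yT; rewrite RintegralB//.
  - by rewrite Rint_cst.
  - exact: iek ma aA.
  - by apply: continuous_itv_integrable => z; exact: cvg_cst.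
have := @duhamel_integral_equation T (A + `|k|) (expR (`|k| * T) * B) (expR (`|k| * T) * K)
  (fun s => a s - k) (fun s => expR (k * s) * b s) (fun s => expR (k * s) * G s).
rewrite mulr0 expR0 mul1r => H.
have {}H : expR (k * T) * G T = G 0 + \int[mu]_(s in `[0, T])
   (expR (k * s) * b s - (a s - k) * (expR (k * s) * G s)).
  apply: H => //.
  - exact: measurable_funB.
  - by move=> s /aA h; apply: le_trans (ler_normB _ _) _; rewrite lerD2r.
  - exact: measurable_funM.
  - by move=> s s0T; rewrite normrM ler_pM// ?kE// bB.
  - exact: measurable_funM.
  - by move=> s s0T; rewrite normrM ler_pM// ?kE// GK.
  move=> t t0T; rewrite (mild t t0T) mulrDr; move: t0T => /andP[t0 tT].
  congr (_ + _).
    rewrite akI// subr0 mulrCA; congr (_ * _).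
    by rewrite -expRD; congr expR; lra.
  rewrite -RintegralZl; [|by []|]; last first.
    pose I s := \int[mu]_(u in `[0, s]) a u.
    have mI : measurable_fun `[0, T] I by exact: measurable_primitive aA.
    have IB s : 0 <= s -> s <= t -> I t - I s = \int[mu]_(u in `[s, t]) a u.
      by move=> s0 st; exact: primitive_diff aA _ _ _.
    have i1 : mu.-integrable `[0, t] (EFin \o (fun s => expR (I s - I t) * b s)).
      apply: (@itv_integrable _ _ _ _ (expR (A * T) * B)).
        apply: (@itv_measurableS T) => //; apply: measurable_funM => //.
        by apply: measurableT_comp => //; exact: measurable_funB.
      move=> s /andP[s0 st]; rewrite normrM ler_pM//; last first.
        by apply: bB; rewrite s0 (le_trans st).
      rewrite ger0_norm ?expR_ge0// ler_expR -opprB IB//.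
      apply: le_trans (ler_norm _) _; rewrite normrN.
      apply: le_trans (Rint_bound _ _ _) _; first exact: st.
      - exact: itv_measurableS ma.
      - by move=> u /andP[su ut]; apply: aA; rewrite (le_trans s0 su) (le_trans ut).
      - have A0 : 0 <= A by apply: le_trans (aA 0 _); rewrite ?lexx.
        by rewrite ler_wpM2l//; lra.
    apply: eq_integrable i1 => // s; rewrite inE/= in_itv/= => /andP[s0 st].
    by rewrite -opprB IB.
  apply: eq_Rintegral => s; rewrite inE/= in_itv/= => /andP[s0 st].
  rewrite akI// !mulrA -!expRD; congr (expR _ * _); lra.
have -> : G T = expR (- (k * T)) * (expR (k * T) * G T).
  by rewrite mulrA -expRD addNr expR0 mul1r.
rewrite H mulrDr; congr (_ + _).
rewrite -RintegralZl//; last first.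
  apply: (@iek (expR (`|k| * T) * B + (A + `|k|) * (expR (`|k| * T) * K))) => //.
    apply: measurable_funB; first exact: measurable_funM.
    by apply: measurable_funM; [exact: measurable_funB|exact: measurable_funM].
  move=> s s0T; apply: le_trans (ler_normB _ _) _; apply: lerD.
    by rewrite normrM ler_pM// ?kE// bB.
  rewrite normrM ler_pM//.
    by apply: le_trans (ler_normB _ _) _; rewrite lerD2r aA.
  by rewrite normrM ler_pM// ?kE// GK.
apply: eq_Rintegral => s _.
have -> : - (k * (T - s)) = - (k * T) + k * s by ring.
rewrite expRD; ring.
Qed.

End Duhamel.

(** * Compactly supported sub-solutions of positive operators *)

Section PositiveFunctional.
Variable R : realType.
Implicit Types (f g h : R -> R).

Definition pos (x : R) : R := Num.max 0 x.

Lemma pos_ge0 x : 0 <= pos x. Proof. by rewrite /pos le_max lexx. Qed.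
Lemma pos_ge x : x <= pos x. Proof. by rewrite /pos le_max lexx orbT. Qed.
Lemma pos_eq0 x : x <= 0 -> pos x = 0.
Proof. by move=> x0; rewrite /pos max_l. Qed.
Lemma pos_id x : 0 <= x -> pos x = x.
Proof. by move=> x0; rewrite /pos max_r. Qed.
Lemma posB x : pos x - pos (- x) = x.
Proof.
by have [x0|x0] := lerP 0 x; [rewrite pos_id// pos_eq0 ?subr0 ?oppr_le0|
  rewrite pos_eq0 ?(ltW x0)// pos_id ?sub0r ?opprK// oppr_ge0 ltW].
Qed.

Lemma continuous_pos f : continuous f -> continuous (fun x : R => pos (f x)).
Proof. by move=> cf x; apply: continuous_max; [exact: cvg_cst|exact: cf]. Qed.

(** The form of continuity that monotonicity and linearity of a functional
    give for its exponential moments. *)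
Lemma continuous_locally_lipschitz h :
  (forall B, 0 <= B -> exists C, forall x y, `|x| <= B -> `|y| <= B ->
     `|h x - h y| <= C * `|x - y|) -> continuous h.
Proof.
move=> H a.
have [C HC] := H (`|a| + 1) (addr_ge0 (normr_ge0 _) ler01).
have C0 : 0 <= C.
  have h1 : `|a| <= `|a| + 1 by rewrite lerDl.
  have h2 : `|a + 1| <= `|a| + 1 by rewrite (le_trans (ler_normD _ _))// normr1.
  have := HC a (a + 1) h1 h2.
  rewrite opprD addrA subrr add0r normrN normr1 mulr1.
  by apply: le_trans.
apply/cvgrPdist_lt => e e0.
have d0 : 0 < Num.min 1 (e / (C + 1)).
  by rewrite lt_min ltr01/= divr_gt0// ltr_wpDl.
near=> x.
have xa : `|a - x| < Num.min 1 (e / (C + 1)).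
  by near: x; apply: cvgr_dist_lt.
move: xa; rewrite lt_min => /andP[x1 x2].
have hx : `|x| <= `|a| + 1.
  have -> : x = a - (a - x) by rewrite opprB addrC subrK.
  by rewrite (le_trans (ler_normB _ _))// lerD2l ltW.
apply: le_lt_trans (HC a x _ hx) _; first by rewrite lerDl.
move: x2; rewrite ltr_pdivlMr; last by rewrite ltr_wpDl.
by have := normr_ge0 (a - x); nra.
Unshelve. all: by end_near.
Qed.

Lemma expR_lipschitz (a b B : R) : `|a| <= B -> `|b| <= B ->
  `|expR a - expR b| <= `|a - b| * expR B.
Proof.
have side x y : `|x| <= B -> expR x - expR y <= `|x - y| * expR B.
  move=> xB.
  have h : expR x - expR y <= (x - y) * expR x.
    have := expR_ge1Dx (y - x).
    rewrite expRB ler_pdivlMr ?expR_gt0// => h; lra.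
  apply: le_trans h _.
  apply: (@le_trans _ _ (`|x - y| * expR x)).
    by rewrite ler_wpM2r ?expR_ge0// ler_norm.
  rewrite ler_wpM2l// ler_expR.
  by apply: le_trans xB; exact: ler_norm.
move=> aB bB; rewrite ler_norml; apply/andP; split; last exact: side.
by rewrite lerNl opprB distrC; exact: side.
Qed.

Lemma continuous_bounded_itv f (A : R) : continuous f ->
  exists2 B, 0 <= B & forall z, `|z| <= A -> `|f z| <= B.
Proof.
move=> cf.
have cA : compact (f @` `[- A, A]).
  by apply: continuous_compact; [exact: continuous_subspaceT|exact: segment_compact].
have [B [_ HB]] := compact_bounded cA.
exists (`|B| + 1); first by rewrite addr_ge0.
move=> z zA; apply: HB; first by rewrite (le_lt_trans (ler_norm _))// ltrDl.
by exists z => //=; rewrite in_itv/= -ler_norml.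
Qed.

Variables (A : R) (T : (R -> R) -> R).
Hypothesis A_ge0 : 0 <= A.
Hypothesis T_le : forall f g, continuous f -> continuous g ->
  (forall z, `|z| <= A -> f z <= g z) -> T f <= T g.
Hypothesis T_add : forall f g, continuous f -> continuous g ->
  T (fun z => f z + g z) = T f + T g.
Hypothesis T_scale : forall k f, continuous f -> T (fun z => k * f z) = k * T f.

Lemma T_cst k : T (fun _ => k) = k * T (fun _ => 1).
Proof.
rewrite -T_scale; last exact: continuous_cstf.
by congr T; apply/funext => z; rewrite mulr1.
Qed.

Lemma T_sub f g : continuous f -> continuous g ->
  T (fun z => f z - g z) = T f - T g.
Proof.
move=> cf cg; rewrite T_add//; last exact: continuousNf.
congr (_ + _); rewrite -mulN1r -T_scale//.
by congr T; apply/funext => z; rewrite mulN1r.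
Qed.

Lemma T_bound f B : continuous f -> (forall z, `|z| <= A -> `|f z| <= B) ->
  `|T f| <= B * T (fun _ => 1).
Proof.
move=> cf fB; rewrite ler_norml -mulNr -!T_cst; apply/andP; split.
  apply: T_le => //; first exact: continuous_cstf.
  by move=> z /fB; rewrite ler_norml => /andP[].
apply: T_le => //; first exact: continuous_cstf.
by move=> z /fB; rewrite ler_norml => /andP[].
Qed.

Lemma T_exp_continuous h : continuous h ->
  continuous (fun lam : R => T (fun z => h z * expR (lam * z))).
Proof.
move=> ch; apply: continuous_locally_lipschitz => K K0.
have [B B0 hB] := continuous_bounded_itv A ch.
exists (B * (A * expR (K * A)) * T (fun _ => 1)) => x y xK yK.
have ce (l : R) : continuous (fun z : R => h z * expR (l * z)).
  by apply: continuousMf => //; exact: continuous_expRZ.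
rewrite -T_sub//.
have H z : `|z| <= A ->
  `|h z * expR (x * z) - h z * expR (y * z)| <= B * (A * expR (K * A)) * `|x - y|.
  move=> zA; rewrite -mulrBr normrM -mulrA ler_pM// ?hB//.
  have xz (l : R) : `|l| <= K -> `|l * z| <= K * A.
    by move=> lK; rewrite normrM ler_pM.
  apply: le_trans (expR_lipschitz (xz x xK) (xz y yK)) _.
  rewrite -mulrBl normrM.
  have -> : A * expR (K * A) * `|x - y| = `|x - y| * A * expR (K * A) by ring.
  by rewrite ler_wpM2r ?expR_ge0// ler_wpM2l.
have cd : continuous (fun z : R => h z * expR (x * z) - h z * expR (y * z)).
  by apply: continuousDf => //; exact: continuousNf.
by apply: le_trans (T_bound cd H) _; rewrite le_eqVlt; apply/orP; left; apply/eqP; ring.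
Qed.

Let cexp := continuous_expRZ.
Let cpos := continuous_pos (@continuous_idf R).

Lemma T_exp_ge lam : 0 <= lam -> lam * T pos <= T (fun z => expR (lam * z)).
Proof.
move=> l0; rewrite -T_scale; last exact: cpos.
apply: T_le; last 1 first.
- move=> z _; have [z0|z0] := lerP 0 z.
    rewrite pos_id//; have := expR_ge1Dx (lam * z); lra.
  by rewrite pos_eq0 ?(ltW z0)// mulr0 expR_ge0.
- by apply: continuousMf; [exact: continuous_cstf|exact: cpos].
- exact: cexp.
Qed.

(** The first moment of the tilted functional is negative without tilt.  It is
    positive for a large tilt [lam], because
    [lam * z * exp (lam * z) >= exp (lam * z) - 1] and [T (exp (lam * z))] grows
    at least like [lam * T pos]. *)
Lemma critical_tilt : T id < 0 -> 0 < T pos ->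
  exists2 lam, 0 <= lam & T (fun z => z * expR (lam * z)) = 0.
Proof.
move=> T0 Tp.
have T10 : 0 <= T (fun=> 1).
  have := @T_le (fun=> 0) (fun=> 1) (@continuous_cstf R 0) (@continuous_cstf R 1).
  by rewrite T_cst mul0r; apply => z _.
pose Lam := (T (fun=> 1) + 1) / T pos.
have Lam0 : 0 < Lam by rewrite divr_gt0// ltr_wpDl.
pose F (lam : R) := T (fun z => z * expR (lam * z)).
have cF : continuous F by apply: T_exp_continuous; exact: continuous_idf.
have F0 : F 0 < 0.
  rewrite /F (_ : (fun z => z * expR (0 * z)) = id)//.
  by apply/funext => z; rewrite mul0r expR0 mulr1.
have FL : 0 < F Lam.
  suff : 0 < Lam * F Lam by rewrite pmulr_rgt0.
  apply: (@lt_le_trans _ _ (T (fun z => expR (Lam * z)) - T (fun=> 1))).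
    rewrite subr_gt0; apply: lt_le_trans (T_exp_ge (ltW Lam0)).
    by rewrite /Lam divfK ?gt_eqF// ltrDl.
  rewrite /F -T_scale; last first.
    by apply: continuousMf; [exact: continuous_idf|exact: cexp].
  rewrite -T_sub; [|exact: cexp|exact: continuous_cstf].
  apply: T_le.
  - by apply: continuousDf; [exact: cexp|exact: continuous_cstf].
  - apply: continuousMf; first exact: continuous_cstf.
    by apply: continuousMf; [exact: continuous_idf|exact: cexp].
  - move=> z _.
    have := expR_ge1Dx (- (Lam * z)); rewrite expRN.
    rewrite -[_^-1]mul1r ler_pdivlMr ?expR_gt0//; lra.
have [||lam + Flam] := @IVT R F 0 Lam 0 (ltW Lam0).
- exact: continuous_subspaceT.
- by rewrite ge_min (ltW F0)/= le_max (ltW FL) orbT.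
by rewrite in_itv/= => /andP[l0 _]; exists lam.
Qed.

(** With [q y = 1 - y^2 / L^2] and [phi y = exp (- lam y) * pos (q y)], the claim
    is [pos (q y) <= T (exp (lam z) * pos (q (y - z)))].  As the first moment
    vanishes, bounding [pos] below by the identity gives
    [T (exp (lam z) * q (y - z)) >= m * (q y - A^2 / L^2)] with [m > 1], which
    suffices where [q y >= C / L^2].  In the remaining boundary layer [q y] is
    of order [1 / L^2], whereas jumps directed towards the origin contribute a
    term of order [1 / L], since [pos (q (y - z)) >= (L * pos z - A^2) / L^2]
    for [y >= L / 2], and symmetrically on the left. *)
Lemma compact_subsolution (lam : R) : 0 <= lam -> 0 < T pos ->
  T (fun z => z * expR (lam * z)) = 0 -> 1 < T (fun z => expR (lam * z)) ->
  exists (phi : R -> R) (L phi0 B : R), [/\ continuous phi, (forall y, 0 <= phi y <= B),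
    (forall y, L <= `|y| -> phi y = 0),
    0 < phi0 /\ (forall y, `|y| <= A -> phi0 <= phi y) &
    forall y, phi y <= T (fun z => phi (y - z))].
Proof.
move=> lam0 Tp T1 m1.
set m := T (fun z => expR (lam * z)) in m1.
pose P := T (fun z => pos z * expR (lam * z)).
have cpe : continuous (fun z : R => pos z * expR (lam * z)).
  by apply: continuousMf; [exact: cpos|exact: cexp].
have cze : continuous (fun z : R => z * expR (lam * z)).
  by apply: continuousMf; [exact: continuous_idf|exact: cexp].
have P0 : 0 < P.
  apply: lt_le_trans Tp _; apply: (T_le cpos cpe).
  move=> z _; have [z0|z0] := lerP 0 z.
    rewrite ler_peMr ?pos_ge0// -expR0 ler_expR mulr_ge0//.
  by rewrite pos_eq0 ?(ltW z0)// mul0r.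
have PN : T (fun z => pos (- z) * expR (lam * z)) = P.
  have -> : (fun z => pos (- z) * expR (lam * z)) =
     (fun z => pos z * expR (lam * z) - z * expR (lam * z)).
    by apply/funext => z; rewrite -mulrBl; congr (_ * _); have := posB z; lra.
  by rewrite T_sub// T1 subr0.
have m10 : 0 < m - 1 by rewrite subr_gt0.
have m0 : 0 < m by apply: lt_trans m1.
(* [C / L^2] is the height of [q] at which the boundary layer begins. *)
have [C C0 CE] : exists2 C : R, 0 <= C & (m - 1) * C = m * A ^+ 2.
  exists (m * A ^+ 2 / (m - 1)).
    by rewrite divr_ge0 ?mulr_ge0 ?exprn_ge0// ltW.
  by rewrite mulrC divfK// gt_eqF.
have [D D0 DE] : exists2 D : R, 0 <= D & D * P = A ^+ 2 * m + C.
  exists ((A ^+ 2 * m + C) / P).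
    by rewrite divr_ge0 ?(ltW P0)// addr_ge0// mulr_ge0 ?exprn_ge0// ltW.
  by rewrite divfK// gt_eqF.
have [L [L1 LA LC1 LD]] : exists L : R, [/\ 1 <= L, 2 * A <= L, 2 * C <= L & D <= L].
  exists (2 * A + 1 + 2 * C + D); have A0 := A_ge0; split; lra.
have L0 : 0 < L by lra.
have LC : 2 * C <= L ^+ 2 by nra.
have LP : A ^+ 2 * m + C <= L * P by rewrite -DE ler_pM2r.
have L20 : 0 < L ^+ 2 by rewrite exprn_gt0.
pose q (y : R) := 1 - y ^+ 2 / L ^+ 2.
have cq : continuous q.
  apply: continuousDf; first exact: continuous_cstf.
  apply: continuousNf; apply: continuousMf; last exact: continuous_cstf.
  by apply: continuousMf; exact: continuous_idf.
pose phi y := expR (- lam * y) * pos (q y).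
have cphi : continuous phi.
  by apply: continuousMf; [exact: cexp|exact: continuous_pos].
have q1 y : q y <= 1.
  by rewrite /q gerBl divr_ge0 ?sqr_ge0// ltW.
have qout y : L <= `|y| -> q y <= 0.
  move=> Ly; rewrite /q subr_le0 ler_pdivlMr// mul1r.
  by rewrite -[leRHS]real_normK ?num_real// ler_pXn2r// ?nnegrE// ltW.
exists phi, L, (expR (- lam * A) * (3 / 4)), (expR (lam * L)).
split => //.
- move=> y; apply/andP; split; first by rewrite mulr_ge0 ?expR_ge0 ?pos_ge0.
  have [Ly|yL] := lerP L `|y|.
    by rewrite /phi (pos_eq0 (qout y Ly)) mulr0 expR_ge0.
  rewrite /phi -[leRHS]mulr1 ler_pM ?expR_ge0 ?pos_ge0//; last first.
    by rewrite /pos ge_max ler01 q1.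
  rewrite ler_expR mulNr -mulrN ler_wpM2l//.
  by apply: le_trans (ltW yL); rewrite -normrN ler_norm.
- by move=> y Ly; rewrite /phi (pos_eq0 (qout y Ly)) mulr0.
- split; first by rewrite mulr_gt0 ?expR_gt0//; lra.
  move=> y yA; rewrite /phi ler_pM ?expR_ge0//.
    by rewrite ler_expR !mulNr lerN2 ler_wpM2l// (le_trans (ler_norm _)).
  apply: le_trans (pos_ge _); rewrite /q.
  have : y ^+ 2 <= A ^+ 2.
    by rewrite -[leLHS]real_normK ?num_real// ler_pXn2r// ?nnegrE.
  have : y ^+ 2 / L ^+ 2 <= 1 / 4 <-> y ^+ 2 <= L ^+ 2 / 4.
    by rewrite ler_pdivrMr// mulrC mul1r mulrC.
  have : (2 * A) ^+ 2 <= L ^+ 2 by rewrite ler_pXn2r ?nnegrE ?mulr_ge0// ltW.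
  rewrite exprMn => h1 [_ h2] h3.
  have : y ^+ 2 / L ^+ 2 <= 1 / 4 by apply: h2; lra.
  lra.
move=> y.
have -> : (fun z => phi (y - z)) =
    (fun z => expR (- lam * y) * (expR (lam * z) * pos (q (y - z)))).
  apply/funext => z; rewrite /phi mulrA -expRD; congr (expR _ * _); ring.
have cyz : continuous (fun z : R => q (y - z)).
  move=> z; apply: (@continuous_comp _ _ _ (fun z : R => y - z) q); last exact: cq.
  by apply: cvgB; [exact: cvg_cst|exact: cvg_id].
have cT : continuous (fun z : R => expR (lam * z) * pos (q (y - z))).
  by apply: continuousMf; [exact: cexp|exact: continuous_pos].
rewrite T_scale// {1}/phi ler_pM2l ?expR_gt0//.
have [q0|q0] := lerP (q y) 0.
  rewrite pos_eq0//.
  have := @T_le (fun=> 0) _ (@continuous_cstf R 0) cT; rewrite T_cst mul0r; apply.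
  by move=> z _; rewrite mulr_ge0 ?expR_ge0 ?pos_ge0.
rewrite (pos_id (ltW q0)).
have zA2 z : `|z| <= A -> z ^+ 2 <= A ^+ 2.
  by move=> zA; rewrite -[leLHS]real_normK ?num_real// ler_pXn2r// ?nnegrE.
have qyz z : q (y - z) = q y + (2 * y * z - z ^+ 2) / L ^+ 2.
  rewrite /q; field; exact: lt0r_neq0.
have lin (a b : R) (h : R -> R) : continuous (fun z : R => h z * expR (lam * z)) ->
  continuous (fun z : R => a * expR (lam * z) + b * (h z * expR (lam * z))) /\
  T (fun z => a * expR (lam * z) + b * (h z * expR (lam * z))) =
  a * m + b * T (fun z => h z * expR (lam * z)).
  move=> ch.
  have c1 : continuous (fun z : R => a * expR (lam * z)).
    by apply: continuousMf; [exact: continuous_cstf|exact: cexp].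
  have c2 : continuous (fun z : R => b * (h z * expR (lam * z))).
    by apply: continuousMf; first exact: continuous_cstf.
  split; first exact: continuousDf.
  by rewrite T_add// !T_scale//; exact: cexp.
have [qC|qC] := lerP (C / L ^+ 2) (q y).
  have [c1 e1] := lin (q y - A ^+ 2 / L ^+ 2) (2 * y / L ^+ 2) id cze.
  apply: (@le_trans _ _ ((q y - A ^+ 2 / L ^+ 2) * m)).
    have : (m - 1) * (C / L ^+ 2) <= (m - 1) * q y by rewrite ler_pM2l.
    have -> : (m - 1) * (C / L ^+ 2) = m * (A ^+ 2 / L ^+ 2).
      by rewrite mulrA CE mulrA.
    lra.
  have -> : (q y - A ^+ 2 / L ^+ 2) * m = T (fun z =>
    (q y - A ^+ 2 / L ^+ 2) * expR (lam * z) + 2 * y / L ^+ 2 * (z * expR (lam * z))).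
    by rewrite e1 T1 mulr0 addr0.
  apply: T_le => // z zA.
  rewrite mulrA -mulrDl mulrC ler_pM2l ?expR_gt0//.
  apply: le_trans (pos_ge _); rewrite qyz.
  have -> : q y - A ^+ 2 / L ^+ 2 + 2 * y / L ^+ 2 * z
     = q y + (2 * y * z - A ^+ 2) / L ^+ 2 by ring.
  by rewrite lerD2l ler_pM2r ?invr_gt0// lerD2l lerN2 zA2.
have y2 : (L / 2) ^+ 2 <= y ^+ 2.
  have : L ^+ 2 * q y < C.
    by move: qC; rewrite ltr_pdivlMr// mulrC.
  have -> : L ^+ 2 * q y = L ^+ 2 - y ^+ 2.
    rewrite /q; field; exact: lt0r_neq0.
  rewrite expr_div_n; lra.
(* The boundary layer, on either side: [h] is [pos z] or [pos (- z)], which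
   have the same tilted moment [P] because the first moment vanishes. *)
have fin (h : R -> R) : continuous (fun z : R => h z * expR (lam * z)) ->
   T (fun z => h z * expR (lam * z)) = P ->
   (forall z, `|z| <= A -> (L * h z - A ^+ 2) / L ^+ 2 <= pos (q (y - z))) ->
   q y <= T (fun z => expR (lam * z) * pos (q (y - z))).
  move=> ch hP hz.
  have [c1 e1] := lin (- A ^+ 2 / L ^+ 2) (L / L ^+ 2) h ch.
  apply: (@le_trans _ _ (T (fun z => (- A ^+ 2 / L ^+ 2) * expR (lam * z) +
     (L / L ^+ 2) * (h z * expR (lam * z))))).
    rewrite e1 hP; apply: le_trans (ltW qC) _.
    have -> : - A ^+ 2 / L ^+ 2 * m + L / L ^+ 2 * P = (L * P - A ^+ 2 * m) / L ^+ 2.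
      by ring.
    by rewrite ler_pM2r ?invr_gt0//; lra.
  apply: T_le => // z zA.
  rewrite mulrA -mulrDl mulrC ler_pM2l ?expR_gt0//.
  apply: le_trans (hz z zA); rewrite le_eqVlt; apply/orP; left; apply/eqP; ring.
have neg0 : - (A ^+ 2) / L ^+ 2 <= 0.
  by rewrite mulNr oppr_le0 divr_ge0 ?exprn_ge0// ltW.
have [y0|y0] := lerP 0 y.
  apply: (fin pos) => // z zA.
  have [z0|z0] := lerP 0 z; last first.
    rewrite pos_eq0 ?(ltW z0)// mulr0 sub0r.
    by apply: le_trans neg0 _; exact: pos_ge0.
  rewrite pos_id//; apply: le_trans (pos_ge _); rewrite qyz.
  apply: ler_wpDl; first exact: ltW.
  rewrite ler_pM2r ?invr_gt0//.
  have Ly : L / 2 <= y by move: y2; rewrite ler_pXn2r// ?nnegrE// divr_ge0// ltW.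
  have := zA2 z zA; nra.
apply: (fin (fun z => pos (- z))) => //.
  apply: continuousMf; last exact: cexp.
  by apply: continuous_pos; apply: continuousNf; exact: continuous_idf.
move=> z zA.
have [z0|z0] := lerP z 0; last first.
  rewrite pos_eq0 ?oppr_le0 ?(ltW z0)// mulr0 sub0r.
  by apply: le_trans neg0 _; exact: pos_ge0.
rewrite pos_id ?oppr_ge0//; apply: le_trans (pos_ge _); rewrite qyz.
apply: ler_wpDl; first exact: ltW.
rewrite ler_pM2r ?invr_gt0//.
have a1 : L / 2 \is Num.nneg by rewrite nnegrE divr_ge0// ltW.
have a2 : - y \is Num.nneg by rewrite nnegrE oppr_ge0 ltW.
have Ly : L / 2 <= - y.
  by move: y2; rewrite -[y ^+ 2]sqrrN (ler_pXn2r _ a1 a2).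
have := zA2 z zA; nra.
Qed.

End PositiveFunctional.

(** * Displacement after a cut exponential flight *)

Section Jump.
Variables (R : realType).
Implicit Types (f g : R -> R) (S k w : R).
Notation mu := (@lebesgue_measure R).

(** Mean of [f] at the displacement of a particle of relative velocity [w]
    after an exponential flight time, flights longer than [S] being discarded. *)
Definition flight (S : R) (f : R -> R) (w : R) : R :=
  \int[mu]_(s in `[0, S]) (expR (- s) * f (w * s)).

Lemma continuous_expN : continuous (fun s : R => expR (- s)).
Proof.
by move=> x; apply: (@continuous_comp _ _ _ (fun s : R => - s) expR);
  [apply: cvgN; exact: cvg_id|exact: continuous_expR].
Qed.

Lemma continuous_scaled (f : R -> R) w : continuous f ->
  continuous (fun s : R => f (w * s)).
Proof.
move=> cf x; apply: (@continuous_comp _ _ _ (fun s : R => w * s) f).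
  by apply: cvgM; [exact: cvg_cst|exact: cvg_id].
exact: cf.
Qed.

Lemma flight_integrable (S w : R) f : continuous f ->
  mu.-integrable `[0, S] (EFin \o (fun s => expR (- s) * f (w * s))).
Proof.
move=> cf; apply: continuous_itv_integrable; apply: continuousMf.
  exact: continuous_expN.
exact: continuous_scaled.
Qed.

Lemma flight_add S f g w : continuous f -> continuous g ->
  flight S (fun z => f z + g z) w = flight S f w + flight S g w.
Proof.
move=> cf cg; rewrite /flight -RintegralD//; last 2 first.
- exact: flight_integrable.
- exact: flight_integrable.
by apply: eq_Rintegral => s _; rewrite mulrDr.
Qed.

Lemma flight_scale S k f w : continuous f ->
  flight S (fun z => k * f z) w = k * flight S f w.
Proof.
move=> cf; rewrite /flight -RintegralZl//; last exact: flight_integrable.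
by apply: eq_Rintegral => s _; rewrite mulrCA.
Qed.

Lemma flight_le S W f g w : continuous f -> continuous g ->
  `|w| <= W -> (forall z, `|z| <= W * S -> f z <= g z) ->
  flight S f w <= flight S g w.
Proof.
move=> cf cg wW fg; apply: le_Rintegral => //; [exact: flight_integrable..|].
move=> s; rewrite /= in_itv/= => /andP[s0 sS].
rewrite ler_pM2l ?expR_gt0//; apply: fg; rewrite normrM.
by rewrite (ger0_norm s0) ler_pM.
Qed.

Lemma flight_bound S W f B w : 0 <= S -> continuous f ->
  `|w| <= W -> (forall z, `|z| <= W * S -> `|f z| <= B) ->
  `|flight S f w| <= B * S.
Proof.
move=> S0 cf wW fB; have := @Rint_bound _ 0 S
  (fun s => expR (- s) * f (w * s)) B S0.
rewrite subr0; apply.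
  apply: measurable_funTS; apply: continuous_measurable_fun.
  by apply: continuousMf; [exact: continuous_expN|exact: continuous_scaled].
move=> s /andP[s0 sS]; rewrite normrM -[leRHS]mul1r ler_pM//.
  by rewrite ger0_norm ?expR_ge0// -expR0 ler_expR oppr_le0.
apply: fB; rewrite normrM.
by rewrite (ger0_norm s0) ler_pM.
Qed.

Lemma flight_continuous S f : 0 <= S -> continuous f -> continuous (flight S f).
Proof.
move=> S0 cf w0.
have [B B0 fB] := continuous_bounded_itv ((`|w0| + 1) * S) cf.
have := @continuity_under_integral R _ _ mu (fun w s => expR (- s) * f (w * s))
  `[0, S] (measurable_itv _) (w0 - 1) (w0 + 1) _ _ (fun=> B) _ _ w0.
apply.
- by move=> w _; exact: flight_integrable.
- apply: nearW => s _ w _.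
  apply: cvgM; first exact: cvg_cst.
  apply: (@continuous_comp _ _ _ (fun w : R => w * s) f); last exact: cf.
  by apply: cvgM; [exact: cvg_id|exact: cvg_cst].
- by apply: continuous_itv_integrable => s; exact: cvg_cst.
- move=> w; rewrite /= in_itv/= => /andP[w1 w2].
  apply: nearW => s; rewrite /= in_itv/= => /andP[s0 sS].
  rewrite normrM -[leRHS]mul1r ler_pM//.
    by rewrite ger0_norm ?expR_ge0// -expR0 ler_expR oppr_le0.
  apply: fB; rewrite normrM (ger0_norm s0) ler_pM//.
  have -> : w = w0 + (w - w0) by rewrite addrC subrK.
  rewrite (le_trans (ler_normD _ _))// lerD2l ler_norml; lra.
- by rewrite inE /= in_itv/=; apply/andP; split; lra.
Qed.

Variables (V : set R) (M : R -> R) (c W : R).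
Hypothesis V_meas : measurable V.
Hypothesis M_int : mu.-integrable V (EFin \o M).
Hypothesis M_ge0 : forall v, V v -> 0 <= M v.
Hypothesis W_bound : forall v, V v -> `|v - c| <= W.

(** The scattering operator of the linearised equation, in the frame of
    speed [c].  Discarding long flights makes the jumps bounded by [W * S] and
    all exponential moments finite. *)
Definition jump (S : R) (f : R -> R) : R :=
  \int[mu]_(v in V) (M v * flight S f (v - c)).

Lemma jump_integrable S f : 0 <= S -> continuous f ->
  mu.-integrable V (EFin \o (fun v => M v * flight S f (v - c))).
Proof.
move=> S0 cf.
have [B B0 fB] := continuous_bounded_itv (W * S) cf.
apply: (@integrable_mul_bounded _ _ _ _ (B * S)) => //.
  apply: measurable_funTS; apply: continuous_measurable_fun => v.
  apply: (@continuous_comp _ _ _ (fun v : R => v - c) (flight S f)).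
    by apply: cvgB; [exact: cvg_id|exact: cvg_cst].
  exact: flight_continuous.
by move=> v /W_bound vW; exact: flight_bound vW _.
Qed.

Lemma jump_add S f g : 0 <= S -> continuous f -> continuous g ->
  jump S (fun z => f z + g z) = jump S f + jump S g.
Proof.
move=> S0 cf cg; rewrite /jump -RintegralD//; last 2 first.
- exact: jump_integrable.
- exact: jump_integrable.
by apply: eq_Rintegral => v _; rewrite flight_add// mulrDr.
Qed.

Lemma jump_scale S k f : 0 <= S -> continuous f ->
  jump S (fun z => k * f z) = k * jump S f.
Proof.
move=> S0 cf; rewrite /jump -RintegralZl//; last exact: jump_integrable.
by apply: eq_Rintegral => s _; rewrite flight_scale// mulrCA.
Qed.

Lemma jump_le S f g : 0 <= S -> continuous f -> continuous g ->
  (forall z, `|z| <= W * S -> f z <= g z) -> jump S f <= jump S g.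
Proof.
move=> S0 cf cg fg; apply: le_Rintegral => //; [exact: jump_integrable..|].
by move=> v Vv; rewrite ler_wpM2l ?M_ge0//; exact: (flight_le cf cg (W_bound Vv)).
Qed.

Lemma jump_mono S S' f : 0 <= S -> S <= S' -> continuous f ->
  (forall z, 0 <= f z) -> jump S f <= jump S' f.
Proof.
move=> S0 SS cf f0.
have S'0 : 0 <= S' by exact: le_trans SS.
apply: le_Rintegral => //; [exact: jump_integrable..|].
move=> v Vv; rewrite ler_wpM2l ?M_ge0// /flight.
rewrite (@Rint_split _ 0 S S')//; last exact: flight_integrable.
by rewrite lerDl Rintegral_ge0// => s _; rewrite mulr_ge0// expR_ge0.
Qed.

Definition flight_mean (S : R) := \int[mu]_(s in `[0, S]) (expR (- s) * s).

Lemma flight_mean_gt0 S : 0 < S -> 0 < flight_mean S.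
Proof.
move=> S0.
apply: (@lt_le_trans _ _ (expR (- S) * ((1 * S) ^+ 2 / 2`!%:R))).
  by rewrite mulr_gt0 ?expR_gt0// divr_gt0// exprn_gt0// mul1r.
rewrite -(power_integral 1 1 (ltW S0)) -RintegralZl//; last first.
  exact/continuous_itv_integrable/power_fact_continuous.
apply: le_Rintegral => //.
- apply: integrable_scale => //.
  exact/continuous_itv_integrable/power_fact_continuous.
- apply: continuous_itv_integrable; apply: continuousMf; first exact: continuous_expN.
  exact: continuous_idf.
- move=> s; rewrite /= in_itv/= => /andP[s0 sS].
  rewrite !mul1r expr1 divr1 ler_wpM2r// ler_expR lerN2//.
Qed.

Lemma flight_id S w : flight S (fun z => z) w = flight_mean S * w.
Proof.
rewrite /flight /flight_mean mulrC -RintegralZl//; last first.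
  apply: continuous_itv_integrable; apply: continuousMf; first exact: continuous_expN.
  exact: continuous_idf.
by apply: eq_Rintegral => s _; ring.
Qed.

Lemma flight_pos S w : flight S (@pos R) w = flight_mean S * pos w.
Proof.
rewrite /flight /flight_mean mulrC -RintegralZl//; last first.
  apply: continuous_itv_integrable; apply: continuousMf; first exact: continuous_expN.
  exact: continuous_idf.
apply: eq_Rintegral => s; rewrite inE /= in_itv/= => /andP[s0 _].
have [w0|w0] := lerP 0 w.
  by rewrite !pos_id ?mulr_ge0//; ring.
by rewrite !pos_eq0 ?mulr_le0_ge0 ?(ltW w0)// mul0r mulr0.
Qed.

End Jump.

(** * Solutions of the Cauchy problem and their comparison principle *)

Section Solution.
Variables (R : realType) (r : R) (V : set R) (M : R -> R).
Variables (g0 : R -> R -> R) (g : R -> R -> R -> R).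
Notation mu := (@lebesgue_measure R).
Hypothesis r_gt0 : 0 < r.
Hypothesis V_meas : measurable V.
Hypothesis M_meas : measurable_fun V M.
Hypothesis M_ge0 : forall v, V v -> 0 <= M v.
Hypothesis M_mass : (\int[mu]_(v in V) (M v)%:E = 1%E)%E.
Hypothesis g_sol : cauchy_solution r V M g0 g.

Lemma M_integrable : mu.-integrable V (EFin \o M).
Proof.
apply/integrableP; split; first exact/measurable_EFinP.
suff -> : (\int[mu]_(v in V) `|(EFin \o M) v| = 1)%E by rewrite ltry.
rewrite -M_mass; apply: eq_integral => v; rewrite inE => Vv.
by rewrite gee0_abs ?lee_fin ?M_ge0.
Qed.

Lemma M_Rint : \int[mu]_(v in V) M v = 1.
Proof. by rewrite /Rintegral M_mass. Qed.

Lemma dominated_integrable (f : R -> R) (C : R) : measurable_fun V f ->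
  (forall v, V v -> `|f v| <= C * M v) -> mu.-integrable V (EFin \o f).
Proof.
move=> mf fM; apply: (@integrable_le _ V f (fun v => C * M v)) => //.
by apply: integrable_scale => //; exact: M_integrable.
Qed.

Lemma g_ge0 t x v : 0 <= t -> V v -> 0 <= g t x v.
Proof. by case: g_sol => _ h _ t0 Vv; have /andP[] := h t x v t0 Vv. Qed.

Lemma g_leM t x v : 0 <= t -> V v -> g t x v <= M v.
Proof. by case: g_sol => _ h _ t0 Vv; have /andP[] := h t x v t0 Vv. Qed.

Let Dom : set (R * R * R) := [set p : R * R * R | 0 <= p.1.1 /\ V p.2].

Lemma Dom_meas : measurable Dom.
Proof.
have -> : Dom = ((`[0, +oo[%classic `*` setT) `*` V).
  apply/seteqP; split => -[[t x] v] /=; rewrite in_itv/= andbT.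
    by move=> [].
  by move=> [[]].
apply: measurableX; last exact: V_meas.
by apply: measurableX; [exact: measurable_itv|exact: measurableT].
Qed.

Let gx : R * R * R -> R := (fun p => g p.1.1 p.1.2 p.2) \_ Dom.

Lemma gx_meas : measurable_fun setT gx.
Proof.
apply/(measurable_restrictT _ Dom_meas).
by case: g_sol.
Qed.

Lemma gxE t x v : 0 <= t -> V v -> gx ((t, x), v) = g t x v.
Proof. by move=> t0 Vv; rewrite /gx patchE mem_set. Qed.

Lemma gx_ge0 p : 0 <= gx p.
Proof.
case: p => -[t x] v; rewrite /gx patchE; case: ifPn => //.
by rewrite inE => -[/= t0 Vv]; exact: g_ge0.
Qed.

Let rhox (q : R * R) : R := fine (fubini_F mu (EFin \o gx) q).

Lemma rhox_meas : measurable_fun setT rhox.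
Proof.
apply: measurableT_comp => //.
apply: measurable_fun_fubini_tonelli_F.
- by apply/measurable_EFinP; exact: gx_meas.
- by move=> p; rewrite lee_fin gx_ge0.
Qed.

Lemma rhoxE t x : 0 <= t -> rhox (t, x) = rho V g t x.
Proof.
move=> t0; rewrite /rhox /fubini_F /rho /Rintegral; congr fine.
rewrite [RHS]integral_mkcond; apply: eq_integral => v _.
rewrite /gx /= !patchE; have [vV|vV] := boolP (v \in V).
  by rewrite mem_set//=; split => //; rewrite inE in vV.
case: ifPn => //; rewrite inE => -[_ /= Vv].
by move: vV; rewrite notin_setE.
Qed.

Lemma g_slice_meas t x : 0 <= t -> measurable_fun V (g t x).
Proof.
move=> t0; apply: (@eq_measurable_fun _ _ _ _ _ (fun v => gx ((t, x), v))).
  by move=> v; rewrite inE => Vv; rewrite gxE.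
apply: measurable_funTS; apply: measurableT_comp; first exact: gx_meas.
exact: measurable_fun_pair.
Qed.

Lemma g_integrable t x : 0 <= t -> mu.-integrable V (EFin \o g t x).
Proof.
move=> t0; apply: (@dominated_integrable _ 1); first exact: g_slice_meas.
by move=> v Vv; rewrite ger0_norm ?g_ge0// mul1r g_leM.
Qed.

Lemma rho_ge0 t x : 0 <= t -> 0 <= rho V g t x.
Proof. by move=> t0; apply: Rintegral_ge0 => v Vv; exact: g_ge0. Qed.

Lemma rho_le1 t x : 0 <= t -> rho V g t x <= 1.
Proof.
move=> t0; rewrite -M_Rint; apply: le_Rintegral => //.
- exact: g_integrable.
- exact: M_integrable.
- by move=> v Vv; exact: g_leM.
Qed.

Let back (t x v s : R) : R := x - v * (t - s).

Lemma back_meas (t x v : R) (D : set R) : measurable_fun D (back t x v).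
Proof.
apply: measurable_funTS; apply: continuous_measurable_fun => s.
apply: cvgB; first exact: cvg_cst.
by apply: cvgM; [exact: cvg_cst|apply: cvgB; [exact: cvg_cst|exact: cvg_id]].
Qed.

Lemma rho_char_meas (t x v : R) :
  measurable_fun `[0, t] (fun s => rho V g s (back t x v s)).
Proof.
apply: (@eq_measurable_fun _ _ _ _ _ (fun s => rhox (s, back t x v s))).
  by move=> s; rewrite inE/= in_itv/= => /andP[s0 _]; rewrite rhoxE.
apply: measurable_funTS; apply: measurableT_comp; first exact: rhox_meas.
by apply: measurable_fun_pair => //; exact: back_meas.
Qed.

Lemma g_char_meas (t x v : R) : V v ->
  measurable_fun `[0, t] (fun s => g s (back t x v s) v).
Proof.
move=> Vv.
apply: (@eq_measurable_fun _ _ _ _ _ (fun s => gx ((s, back t x v s), v))).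
  by move=> s; rewrite inE/= in_itv/= => /andP[s0 _]; rewrite gxE.
apply: measurable_funTS; apply: measurableT_comp; first exact: gx_meas.
by apply: measurable_fun_pair => //; apply: measurable_fun_pair => //; exact: back_meas.
Qed.

Lemma mild_damping (k t x v : R) : 0 <= t -> V v ->
  g t x v = expR (- (k * t)) * g0 (x - v * t) v
   + \int[mu]_(s in `[0, t])
       (expR (- (k * (t - s))) *
         ((k - (1 + r * rho V g s (x - v * (t - s)))) * g s (x - v * (t - s)) v
          + (1 + r) * M v * rho V g s (x - v * (t - s)))).
Proof.
move=> t0 Vv.
have [_ _ mild] := g_sol.
pose a s := 1 + r * rho V g s (back t x v s).
pose b s := (1 + r) * M v * rho V g s (back t x v s).
pose G s := g s (back t x v s) v.
have r0 := ltW r_gt0.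
have Mv0 := M_ge0 Vv.
have ma : measurable_fun `[0, t] a.
  by apply: measurable_funD => //; apply: measurable_funM => //; exact: rho_char_meas.
have mb : measurable_fun `[0, t] b.
  by apply: measurable_funM => //; exact: rho_char_meas.
have aA s : 0 <= s <= t -> `|a s| <= 1 + r.
  move=> /andP[s0 _]; rewrite ger0_norm /a.
    by rewrite lerD2l ler_piMr// rho_le1.
  by rewrite addr_ge0// mulr_ge0// rho_ge0.
have bB s : 0 <= s <= t -> `|b s| <= (1 + r) * M v.
  move=> /andP[s0 _]; have k0 : 0 <= (1 + r) * M v by rewrite mulr_ge0// addr_ge0.
  rewrite ger0_norm /b.
    by rewrite ler_piMr// rho_le1.
  by rewrite mulr_ge0// rho_ge0.
have GK s : 0 <= s <= t -> `|G s| <= M v.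
  by move=> /andP[s0 _]; rewrite ger0_norm ?g_ge0// g_leM.
have G0 : G 0 = g0 (x - v * t) v.
  rewrite /G (mild 0 _ v (lexx 0) Vv) /back subr0 set_itv1 !Rintegral_set1 oppr0 expR0 mulr1 addr0.
  by rewrite mulr0 subr0.
have backE s u : back t x v s - (s - u) * v = back t x v u.
  by rewrite /back; ring.
have := @duhamel_change_damping _ k t (1 + r) ((1 + r) * M v) (M v) a b G
  t0 ma aA mb bB (@g_char_meas t x v Vv) GK.
have -> : G t = g t x v by rewrite /G /back subrr mulr0 subr0.
rewrite G0 => -> //; last first.
  move=> s /andP[s0 st]; rewrite /G (mild s (back t x v s) v s0 Vv).
  have dampE u w : \int[mu]_(z in `[u, w]) damping r V g s (back t x v s) v z
      = \int[mu]_(z in `[u, w]) a z.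
    by apply: eq_Rintegral => z _; rewrite /damping backE.
  have -> : back t x v s - v * s = x - v * t by rewrite /back; ring.
  rewrite dampE; congr (_ + _); apply: eq_Rintegral => u _.
  rewrite dampE; congr (_ * _); rewrite /b.
  by have -> : back t x v s - v * (s - u) = back t x v u by rewrite /back; ring.
Qed.

(** Source of the equation written with the constant damping [1 + r]; unlike the
    original source it is monotone in [g] and in [rho V g]. *)
Definition gain (t x v : R) : R :=
  r * (1 - rho V g t x) * g t x v + (1 + r) * M v * rho V g t x.

Lemma mild_gain (t x v : R) : 0 <= t -> V v ->
  g t x v = expR (- ((1 + r) * t)) * g0 (x - v * t) v
   + \int[mu]_(s in `[0, t])
       (expR (- ((1 + r) * (t - s))) * gain s (x - v * (t - s)) v).
Proof.
move=> t0 Vv; rewrite (mild_damping (1 + r) x t0 Vv); congr (_ + _).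
by apply: eq_Rintegral => s _; congr (_ * _); rewrite /gain; ring.
Qed.

Lemma gain_char_integrable (t x v : R) : 0 <= t -> V v ->
  mu.-integrable `[0, t] (EFin \o (fun s =>
    expR (- ((1 + r) * (t - s))) * gain s (x - v * (t - s)) v)).
Proof.
move=> t0 Vv.
have r0 := ltW r_gt0.
have Mv0 := M_ge0 Vv.
have mrho := @rho_char_meas t x v.
have mg := @g_char_meas t x v Vv.
apply: (@weight_integrable _ _ _ (r * M v + (1 + r) * M v)).
  apply: measurable_funD; last exact: measurable_funM.
  apply: measurable_funM => //; apply: measurable_funM => //.
  exact: measurable_funB.
move=> s /andP[s0 st].
have := rho_ge0 (x - v * (t - s)) s0.
have := rho_le1 (x - v * (t - s)) s0.
have := g_ge0 (x - v * (t - s)) s0 Vv.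
have := g_leM (x - v * (t - s)) s0 Vv.
rewrite /gain; set G := g _ _ _; set p := rho _ _ _ _ => GM G0 p1 p0.
have q0 : 0 <= 1 - p by rewrite subr_ge0.
rewrite ger0_norm; last by rewrite addr_ge0// !mulr_ge0// addr_ge0.
apply: lerD; last by rewrite ler_piMr// mulr_ge0// addr_ge0.
by apply: ler_pM => //; rewrite ?mulr_ge0// ler_piMr//; lra.
Qed.

(** If [p] exceeds [g] by at most [M * e], its source exceeds [gain] by at most
    [C * M * e]; starting from [p <= M], iteration divides the excess by [n!]. *)
Lemma comparison (C : R) (p src : R -> R -> R -> R) : 0 <= C ->
  (forall t x v, 0 <= t -> V v -> p t x v <= M v) ->
  (forall x v, V v -> p 0 x v <= g0 x v) ->
  (forall t x v, 0 <= t -> V v -> mu.-integrable `[0, t]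
     (EFin \o (fun s => expR (- ((1 + r) * (t - s))) * src s (x - v * (t - s)) v))) ->
  (forall t x v, 0 <= t -> V v ->
     p t x v <= expR (- ((1 + r) * t)) * p 0 (x - v * t) v +
      \int[mu]_(s in `[0, t])
       (expR (- ((1 + r) * (t - s))) * src s (x - v * (t - s)) v)) ->
  (forall t e, 0 <= t -> 0 <= e ->
     (forall x v, V v -> p t x v <= g t x v + M v * e) ->
     forall x v, V v -> src t x v <= gain t x v + C * (M v * e)) ->
  forall t x v, 0 <= t -> V v -> p t x v <= g t x v.
Proof.
move=> C0 pM p0 isrc psub step.
have r0 := ltW r_gt0.
have main n : forall t x v, 0 <= t -> V v ->
   p t x v <= g t x v + M v * ((C * t) ^+ n / n`!%:R).
  elim: n => [|n IH] t x v t0 Vv.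
    rewrite expr0 fact0 divr1 mulr1.
    by rewrite -[leLHS]add0r lerD ?g_ge0// pM.
  apply: le_trans (psub t x v t0 Vv) _.
  rewrite (mild_gain x t0 Vv) -addrA; apply: lerD.
    by rewrite ler_pM2l ?expR_gt0// p0.
  have Cn0 s : 0 <= s -> 0 <= (C * s) ^+ n / n`!%:R.
    by move=> s0; rewrite divr_ge0// exprn_ge0// mulr_ge0.
  have ipow : mu.-integrable `[0, t]
     (EFin \o (fun s => M v * (C * ((C * s) ^+ n / n`!%:R)))).
    by apply: integrable_scale => //; exact/continuous_itv_integrable/power_fact_continuous.
  rewrite -power_integral// -RintegralZl//; last first.
    exact/continuous_itv_integrable/power_fact_continuous.
  rewrite -RintegralD//; last exact: (gain_char_integrable x t0 Vv).
  apply: le_Rintegral => //; first exact: isrc.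
    exact: (integrable_add (measurable_itv _) (gain_char_integrable x t0 Vv) ipow).
  move=> s; rewrite /= in_itv/= => /andP[s0 st].
  have /= := step s ((C * s) ^+ n / n`!%:R) s0 (Cn0 s s0) _ (x - v * (t - s)) v Vv.
  move=> /(_ (fun y w Vw => IH s y w s0 Vw)) h.
  have e1 : expR (- ((1 + r) * (t - s))) <= 1.
    by rewrite -expR0 ler_expR oppr_le0 mulr_ge0 ?subr_ge0 ?addr_ge0//.
  apply: le_trans (ler_wpM2l (expR_ge0 _) h) _.
  rewrite mulrDr lerD2l.
  have -> : M v * (C * ((C * s) ^+ n / n`!%:R)) = C * (M v * ((C * s) ^+ n / n`!%:R)) by ring.
  by rewrite ler_piMl// mulr_ge0// mulr_ge0 ?M_ge0// Cn0.
move=> t x v t0 Vv.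
have h : p t x v - g t x v <= M v * 0.
  have c : M v * ((C * t) ^+ n / n`!%:R) @[n --> \oo] --> M v * 0.
    by apply: cvgMl_tmp; exact: power_fact_cvg0.
  rewrite -(cvg_lim _ c)//; apply: limr_ge; first by apply/cvg_ex; exists (M v * 0).
  by apply: nearW => n; rewrite lerBlDl main.
by move: h; rewrite mulr0 subr_le0.
Qed.

(** * Exponential upper bound *)

(** The damping is at least 1. *)
Lemma g_le_linear (t x v : R) : 0 <= t -> V v ->
  g t x v <= expR (- t) * g0 (x - v * t) v
   + \int[mu]_(s in `[0, t])
       (expR (- (t - s)) * ((1 + r) * M v * rho V g s (x - v * (t - s)))).
Proof.
move=> t0 Vv; rewrite (mild_damping 1 x t0 Vv) mul1r lerD2l.
have r0 := ltW r_gt0.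
have Mv0 := M_ge0 Vv.
have mrho := @rho_char_meas t x v.
have mg := @g_char_meas t x v Vv.
have M1 : measurable_fun `[0, t]
    (fun s => (1 + r) * M v * rho V g s (x - v * (t - s))).
  exact: measurable_funM.
have i2 := @weight_integrable _ 1 t ((1 + r) * M v) _ M1.
have i1 := @weight_integrable _ 1 t (r * M v + (1 + r) * M v)
  (fun s => (1 - (1 + r * rho V g s (x - v * (t - s)))) * g s (x - v * (t - s)) v
          + (1 + r) * M v * rho V g s (x - v * (t - s))).
have -> : \int[mu]_(s in `[0, t])
       (expR (- (t - s)) * ((1 + r) * M v * rho V g s (x - v * (t - s)))) =
  \int[mu]_(s in `[0, t])
       (expR (- (1 * (t - s))) * ((1 + r) * M v * rho V g s (x - v * (t - s)))).
  by apply: eq_Rintegral => s _; rewrite mul1r.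
apply: le_Rintegral => //.
- apply: i1.
    apply: measurable_funD => //; apply: measurable_funM => //.
    apply: measurable_funB => //; apply: measurable_funD => //.
    exact: measurable_funM.
  move=> s /andP[s0 st].
  have := rho_ge0 (x - v * (t - s)) s0.
  have := rho_le1 (x - v * (t - s)) s0.
  have := g_ge0 (x - v * (t - s)) s0 Vv.
  have := g_leM (x - v * (t - s)) s0 Vv.
  set G := g _ _ _; set p := rho _ _ _ _ => GM G0 p1 p0.
  apply: le_trans (ler_normD _ _) _; apply: lerD.
    rewrite normrM opprD addrA subrr add0r normrN.
    apply: ler_pM => //; last by rewrite ger0_norm.
    by rewrite ger0_norm ?mulr_ge0// ler_piMr.
  rewrite ger0_norm; last by rewrite !mulr_ge0// addr_ge0.
  by rewrite ler_piMr// mulr_ge0// addr_ge0.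
- apply: i2 => s /andP[s0 st].
  have := rho_ge0 (x - v * (t - s)) s0.
  have := rho_le1 (x - v * (t - s)) s0.
  set p := rho _ _ _ _ => p1 p0.
  rewrite ger0_norm; last by rewrite !mulr_ge0// addr_ge0.
  by rewrite ler_piMr// mulr_ge0// addr_ge0.
- move=> s; rewrite /= in_itv/= => /andP[s0 st].
  rewrite ler_pM2l ?expR_gt0// gerDr opprD addrA subrr add0r mulNr oppr_le0.
  by rewrite !mulr_ge0// ?rho_ge0 ?g_ge0.
Qed.

Section UpperBound.
Variables (lam cs vm A : R).
Let kap (v : R) : R := 1 + lam * (cs - v).
Let F (v : R) : R := (1 + r) * (M v / kap v).
Let E (t x : R) : R := expR (- (lam * (x - cs * t))).
Hypothesis A_ge0 : 0 <= A.
Hypothesis kap_gt0 : forall v, V v -> v != vm -> 0 < kap v.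
Hypothesis F_int : mu.-integrable V (EFin \o F).
Hypothesis F_mass : \int[mu]_(v in V) F v = 1.
Hypothesis g0_le : forall x v, V v -> v != vm -> g0 x v <= A * E 0 x * F v.

(** [A * E t x * F v] solves the linear equation along each characteristic with
    [v != vm], so in the Picard iteration it reproduces itself and the remainder
    becomes [((1 + r) t)^n / n!]. *)
Lemma rho_exp_bound (t x : R) : 0 <= t -> rho V g t x <= A * E t x.
Proof.
have r0 := ltW r_gt0.
have main n : forall t x, 0 <= t ->
    rho V g t x <= A * E t x + ((1 + r) * t) ^+ n / n`!%:R.
  elim: n => [|n IH] {}t {}x t0.
    rewrite expr0 fact0 divr1; apply: le_trans (rho_le1 _ t0) _.
    by rewrite lerDr mulr_ge0// expR_ge0.
  have e0 s : 0 <= s -> 0 <= ((1 + r) * s) ^+ n / n`!%:R.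
    by move=> s0; rewrite divr_ge0// exprn_ge0// mulr_ge0// addr_ge0.
  have gb v : V v -> v != vm ->
     g t x v <= A * E t x * F v + M v * (((1 + r) * t) ^+ n.+1 / n.+1`!%:R).
    move=> Vv vvm; have k0 := kap_gt0 Vv vvm; have Mv0 := M_ge0 Vv.
    apply: le_trans (g_le_linear x t0 Vv) _.
    pose a := - t - lam * (x - v * t).
    have mrho := @rho_char_meas t x v.
    have j1 : mu.-integrable `[0, t]
        (EFin \o (fun s => A * F v * (kap v * expR (a + kap v * s)))).
      apply: continuous_itv_integrable => s; apply: cvgM; first exact: cvg_cst.
      by apply: cvgM; [exact: cvg_cst|exact: continuous_expR_affine].
    have j2 : mu.-integrable `[0, t]
        (EFin \o (fun s => M v * ((1 + r) * (((1 + r) * s) ^+ n / n`!%:R)))).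
      by apply: integrable_scale => //; exact/continuous_itv_integrable/power_fact_continuous.
    have le2 : \int[mu]_(s in `[0, t])
        (expR (- (t - s)) * ((1 + r) * M v * rho V g s (x - v * (t - s))))
      <= A * F v * (expR (a + kap v * t) - expR a)
         + M v * (((1 + r) * t) ^+ n.+1 / n.+1`!%:R).
      rewrite -Rint_expR_affine// -power_integral// -RintegralZl//; last first.
        apply: continuous_itv_integrable => s.
        by apply: cvgM; [exact: cvg_cst|exact: continuous_expR_affine].
      rewrite -RintegralZl//; last exact/continuous_itv_integrable/power_fact_continuous.
      rewrite -RintegralD//.
      have M1 : measurable_fun `[0, t]
          (fun s => (1 + r) * M v * rho V g s (x - v * (t - s))).
        exact: measurable_funM.
      have i1 := @weight_integrable _ 1 t ((1 + r) * M v) _ M1.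
      apply: le_Rintegral => //.
      - have -> : (fun s => expR (- (t - s)) * ((1 + r) * M v * rho V g s (x - v * (t - s))))
            = (fun s => expR (- (1 * (t - s))) * ((1 + r) * M v * rho V g s (x - v * (t - s)))).
          by apply/funext => s; rewrite mul1r.
        apply: i1 => s /andP[s0 st].
        have := rho_ge0 (x - v * (t - s)) s0.
        have := rho_le1 (x - v * (t - s)) s0.
        set p := rho _ _ _ _ => p1 p0.
        rewrite ger0_norm; last by rewrite !mulr_ge0// addr_ge0.
        by rewrite ler_piMr// mulr_ge0// addr_ge0.
      - exact: (integrable_add (measurable_itv _) j1 j2).
      - move=> s; rewrite /= in_itv/= => /andP[s0 st].
        have KM : 0 <= (1 + r) * M v by rewrite mulr_ge0// addr_ge0.
        apply: (@le_trans _ _ (expR (- (t - s)) * ((1 + r) * M v *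
           (A * E s (x - v * (t - s)) + ((1 + r) * s) ^+ n / n`!%:R)))).
          by rewrite ler_pM2l ?expR_gt0// ler_wpM2l// IH.
        rewrite [_ * (A * _ + _)]mulrDr [expR _ * (_ + _)]mulrDr lerD//.
          rewrite /F /E.
          have -> : A * ((1 + r) * (M v / kap v)) * (kap v * expR (a + kap v * s))
             = A * (1 + r) * M v * expR (a + kap v * s).
            field; exact: lt0r_neq0.
          have -> : a + kap v * s = - (t - s) + - (lam * (x - v * (t - s) - cs * s)).
            by rewrite /a /kap; ring.
          rewrite expRD le_eqVlt; apply/orP; left; apply/eqP; ring.
        have -> : M v * ((1 + r) * (((1 + r) * s) ^+ n / n`!%:R)) =
                  (1 + r) * M v * (((1 + r) * s) ^+ n / n`!%:R) by ring.
        rewrite ler_piMl//; first by rewrite mulr_ge0// e0.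
        by rewrite -expR0 ler_expR oppr_le0 subr_ge0.
    apply: le_trans (lerD (ler_wpM2l (expR_ge0 _) (g0_le (x - v * t) Vv vvm)) le2) _.
    rewrite addrA lerD2r.
    have -> : expR (- t) * (A * E 0 (x - v * t) * F v) = A * F v * expR a.
      have -> : a = - t + - (lam * (x - v * t - cs * 0)) by rewrite /a; ring.
      by rewrite /E expRD; ring.
    rewrite -mulrDr addrC subrK.
    have -> : a + kap v * t = - (lam * (x - cs * t)) by rewrite /a /kap; ring.
    by rewrite /E le_eqVlt; apply/orP; left; apply/eqP; ring.
  have -> : A * E t x + ((1 + r) * t) ^+ n.+1 / n.+1`!%:R =
    \int[mu]_(v in V) (A * E t x * F v + M v * (((1 + r) * t) ^+ n.+1 / n.+1`!%:R)).
    rewrite RintegralD//; last 2 first.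
    - exact: integrable_scale.
    - have := integrable_scale (((1 + r) * t) ^+ n.+1 / n.+1`!%:R) V_meas M_integrable.
      by apply: eq_integrable => // v _ /=; rewrite mulrC.
    rewrite RintegralZl// F_mass mulr1 RintegralZr ?M_Rint ?mul1r//.
    exact: M_integrable.
  apply: (@le_Rintegral_off_point _ _ _ _ vm) => //.
  - exact: g_integrable.
  - apply: integrable_add => //; first exact: integrable_scale.
    have := integrable_scale (((1 + r) * t) ^+ n.+1 / n.+1`!%:R) V_meas M_integrable.
    by apply: eq_integrable => // v _ /=; rewrite mulrC.
move=> t0.
have h : rho V g t x - A * E t x <= 0.
  have c := power_fact_cvg0 (addr_ge0 ler01 r0) t0.
  rewrite -(cvg_lim _ c)//; apply: limr_ge; first by apply/cvg_ex; exists 0.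
  by apply: nearW => n; rewrite lerBlDl main.
by rewrite -subr_le0.
Qed.

Hypothesis kap_ge0 : forall v, V v -> 0 <= kap v.

(** Along a characteristic the bound on [rho] evolves as [exp (kap v * s)] up to
    a constant, after weighting by the damping.  Since [kap] may vanish at the
    largest velocity, this exponential is only bounded by its final value,
    whence the factor [t]. *)
Lemma g_exp_bound (t x v : R) : 0 <= t -> V v -> g0 (x - v * t) v <= M v ->
  g t x v <= expR (- t) * M v + (1 + r) * M v * A * (t * E t x).
Proof.
move=> t0 Vv g0M; apply: le_trans (g_le_linear x t0 Vv) _.
have r0 := ltW r_gt0.
have Mv0 := M_ge0 Vv.
apply: lerD; first by rewrite ler_wpM2l// expR_ge0.
have mrho := @rho_char_meas t x v.
have M1 : measurable_fun `[0, t]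
    (fun s => (1 + r) * M v * rho V g s (x - v * (t - s))).
  exact: measurable_funM.
have i1 := @weight_integrable _ 1 t ((1 + r) * M v) _ M1.
have KM : 0 <= (1 + r) * M v by rewrite mulr_ge0// addr_ge0.
have -> : (1 + r) * M v * A * (t * E t x) =
   \int[mu]_(s in `[0, t]) ((1 + r) * M v * A * E t x).
  by rewrite Rint_cst//; ring.
apply: le_Rintegral => //.
- have -> : (fun s => expR (- (t - s)) * ((1 + r) * M v * rho V g s (x - v * (t - s))))
      = (fun s => expR (- (1 * (t - s))) * ((1 + r) * M v * rho V g s (x - v * (t - s)))).
    by apply/funext => s; rewrite mul1r.
  apply: i1 => s /andP[s0 st].
  have := rho_ge0 (x - v * (t - s)) s0.
  have := rho_le1 (x - v * (t - s)) s0.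
  set p := rho _ _ _ _ => p1 p0.
  by rewrite ger0_norm ?ler_piMr// mulr_ge0.
- by apply: continuous_itv_integrable => s; exact: cvg_cst.
- move=> s; rewrite /= in_itv/= => /andP[s0 st].
  apply: (@le_trans _ _ (expR (- (t - s)) * ((1 + r) * M v * (A * E s (x - v * (t - s)))))).
    by rewrite ler_pM2l ?expR_gt0// ler_wpM2l// rho_exp_bound.
  have -> : expR (- (t - s)) * ((1 + r) * M v * (A * E s (x - v * (t - s)))) =
     (1 + r) * M v * A * (expR (- (t - s)) * E s (x - v * (t - s))) by ring.
  rewrite ler_wpM2l// ?mulr_ge0//; first by rewrite addr_ge0.
  rewrite /E -expRD ler_expR.
  have := mulr_ge0 (kap_ge0 Vv) (_ : 0 <= t - s).
  rewrite subr_ge0 => /(_ st); rewrite /kap; lra.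
Qed.

End UpperBound.

(** * Persistence behind a slower front *)

Section Invasion.
Variables (c S b L phi0 B W gam xL : R) (phi : R -> R).
Hypothesis S_gt0 : 0 < S.
Hypothesis b_range : 1 <= b < 1 + r.
Hypothesis phi_cont : continuous phi.
Hypothesis phiB : forall y, 0 <= phi y <= B.
Hypothesis phiL : forall y, L <= `|y| -> phi y = 0.
Hypothesis phi0_gt0 : 0 < phi0.
Hypothesis phi_core : forall y, `|y| <= W * S -> phi0 <= phi y.
Hypothesis phi_sub : forall y, phi y <= b * jump V M c S (fun z => phi (y - z)).
Hypothesis W_bound : forall v, V v -> `|v - c| <= W.
Hypothesis gam_range : 0 < gam < 1.
Hypothesis g0_ge0 : forall x v, V v -> 0 <= g0 x v.
Hypothesis g0_ge : forall x v, x <= xL -> V v -> gam * M v <= g0 x v.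

(** [M v * H y v] is the distribution of particles that left the source [phi]
    within the last [S] units of time, seen in the moving frame. *)
Let H (y v : R) : R := b * flight S (fun z => phi (y - z)) (v - c).

Let phi_shift y : continuous (fun z : R => phi (y - z)).
Proof.
move=> z; apply: (@continuous_comp _ _ _ (fun z : R => y - z) phi); last exact: phi_cont.
by apply: cvgB; [exact: cvg_cst|exact: cvg_id].
Qed.

Let b_ge0 : 0 <= b.
Proof. by have /andP[b1 _] := b_range; exact: le_trans ler01 b1. Qed.

Let B_ge0 : 0 <= B.
Proof. by have /andP[h1 h2] := phiB 0; exact: le_trans h1 h2. Qed.

Let H_le y v : V v -> H y v <= b * B * S.
Proof.
move=> Vv; rewrite /H -mulrA ler_wpM2l//.
apply: le_trans (ler_norm _) _.
apply: (flight_bound (ltW S_gt0) (@phi_shift y) (W_bound Vv)) => z _.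
by have /andP[h1 h2] := phiB (y - z); rewrite ger0_norm.
Qed.

Let H_eq0 y v : V v -> L + W * S <= y -> H y v = 0.
Proof.
move=> Vv yL; rewrite /H /flight.
have -> : \int[mu]_(s in `[0, S]) (expR (- s) * phi (y - (v - c) * s)) =
          \int[mu]_(s in `[0, S]) (0 : R).
  apply: eq_Rintegral => s; rewrite inE/= in_itv/= => /andP[s0 sS].
  rewrite phiL ?mulr0//; apply: le_trans (ler_norm _).
  have : (v - c) * s <= W * S.
    apply: le_trans (ler_norm _) _; rewrite normrM (ger0_norm s0).
    by rewrite ler_pM// W_bound.
  lra.
by rewrite Rint_cst ?(ltW S_gt0)// mul0r mulr0.
Qed.

Let H_core v : V v -> b * (phi0 * expR (- S) * S) <= H 0 v.
Proof.
move=> Vv; rewrite /H ler_wpM2l//.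
have := @Rint_cst R 0 S (phi0 * expR (- S)) (ltW S_gt0).
rewrite subr0 => <-; apply: le_Rintegral => //.
- by apply: continuous_itv_integrable; exact: continuous_cstf.
- exact: (flight_integrable S (v - c) (@phi_shift 0)).
move=> s; rewrite /= in_itv/= => /andP[s0 sS].
rewrite mulrC ler_pM ?expR_ge0 ?(ltW phi0_gt0)//.
  by rewrite ler_expR lerN2.
apply: phi_core; rewrite sub0r normrN normrM (ger0_norm s0).
by rewrite ler_pM// W_bound.
Qed.

Section Shifted.
Variables (eta x0 : R).
Hypothesis eta_gt0 : 0 < eta.
Hypothesis eta_gam : eta * (b * B * S) <= gam.
Hypothesis eta_r : r * (eta * (b * B * S)) <= 1 + r - b.
Hypothesis eta_B : eta * B <= 1.
Hypothesis x0_le : x0 + L + W * S <= xL.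

Let p (t x v : R) : R := eta * (M v * H (x - c * t - x0) v).
Let src (t x v : R) : R := r * p t x v + b * M v * (eta * phi (x - c * t - x0)).

Let p_le (t x v : R) : V v -> p t x v <= eta * (b * B * S) * M v.
Proof.
move=> Vv; rewrite /p [leRHS]mulrAC -mulrA ler_wpM2l ?(ltW eta_gt0)//.
by rewrite ler_wpM2l ?M_ge0// H_le.
Qed.

(** The density of [p] dominates [eta * phi], and [p] is so small that
    [r * p <= (1 + r - b) * M]: this turns the linear rate [b] into the
    nonlinear source. *)
Let step (t e : R) : 0 <= t -> 0 <= e ->
  (forall x v, V v -> p t x v <= g t x v + M v * e) ->
  forall x v, V v -> src t x v <= gain t x v + (1 + 2 * r) * (M v * e).
Proof.
move=> t0 e0 pg x v Vv.
set y := x - c * t - x0.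
have ph : eta * phi y <= rho V g t x + e.
  have iflight := jump_integrable V_meas M_integrable W_bound (ltW S_gt0) (@phi_shift y).
  have -> : rho V g t x + e = \int[mu]_(w in V) (g t x w + M w * e).
    rewrite RintegralD//; last 2 first.
    - exact: g_integrable.
    - have := integrable_scale e V_meas M_integrable.
      by apply: eq_integrable => // w _ /=; rewrite mulrC.
    by rewrite RintegralZr ?M_Rint ?mul1r//; exact: M_integrable.
  apply: (@le_trans _ _ (\int[mu]_(w in V) p t x w)); last first.
    apply: le_Rintegral => //.
    - have := integrable_scale (eta * b) V_meas iflight.
      by apply: eq_integrable => // w _ /=; rewrite /p /H -/y; congr EFin; ring.
    - apply: integrable_add => //; first exact: g_integrable.
      have := integrable_scale e V_meas M_integrable.
      by apply: eq_integrable => // w _ /=; rewrite mulrC.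
    - by move=> w Vw; exact: pg.
  have -> : \int[mu]_(w in V) p t x w = eta * b * jump V M c S (fun z => phi (y - z)).
    rewrite /jump -RintegralZl//; apply: eq_Rintegral => w _.
    by rewrite /p /H -/y; ring.
  by rewrite -mulrA ler_wpM2l ?(ltW eta_gt0).
have /andP[ph0 phB] := phiB y.
have a0 : 0 <= eta * phi y by rewrite mulr_ge0 ?(ltW eta_gt0).
have a1 : eta * phi y <= 1.
  by apply: le_trans eta_B; rewrite ler_wpM2l ?(ltW eta_gt0).
have Mv := M_ge0 Vv.
have pgv := pg x v Vv.
have rp : r * p t x v <= (1 + r - b) * M v.
  apply: (@le_trans _ _ (r * (eta * (b * B * S) * M v))).
    by rewrite ler_wpM2l ?(ltW r_gt0)// p_le.
  by rewrite mulrA ler_wpM2r.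
have gM := g_leM x t0 Vv.
have G0 := g_ge0 x t0 Vv.
have rho0 := rho_ge0 x t0.
rewrite /src /gain -/y.
move: (p t x v) (g t x v) (rho V g t x) (eta * phi y) (M v) Mv rp pgv gM G0 rho0 a0 a1 ph.
move=> P G rh a m m0 rp pg' Gm G0 rh0 a0 a1 ar.
have r0 := r_gt0.
have h1 : r * P * a <= (1 + r - b) * m * a by rewrite ler_wpM2r.
have h2 : r * (1 - a) * P <= r * (1 - a) * (G + m * e).
  by rewrite ler_wpM2l// mulr_ge0 ?subr_ge0// ltW.
have h3 : a * ((1 + r) * m - r * G) <= (rh + e) * ((1 + r) * m - r * G).
  rewrite ler_wpM2r// subr_ge0.
  have : r * G <= r * m by rewrite ler_pM2l.
  lra.
have h4 : 0 <= r * a * (m * e) by rewrite !mulr_ge0// ltW.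
have h5 : 0 <= e * (r * G) by rewrite !mulr_ge0// ltW.
lra.
Qed.

Let frame_char (t x v s : R) : x - v * (t - s) - c * s - x0 = (x - v * t - x0) + (v - c) * s.
Proof. by ring. Qed.

Let profile (x v u : R) : R := phi (x + (v - c) * u).
Let memory (x v s : R) : R :=
  \int[mu]_(y in `[0, S]) (expR (- y) * profile x v (s - y)).

Let profile_cont (x v : R) : continuous (profile x v).
Proof.
move=> u; apply: (@continuous_comp _ _ _ (fun u : R => x + (v - c) * u) phi);
  last exact: phi_cont.
apply: cvgD; first exact: cvg_cst.
by apply: cvgM; [exact: cvg_cst|exact: cvg_id].
Qed.

Let p_char (t x v s : R) :
  p s (x - v * (t - s)) v = eta * (b * M v) * memory (x - v * t - x0) v s.
Proof.
rewrite /p /H frame_char.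
have -> : flight S (fun z => phi (x - v * t - x0 + (v - c) * s - z)) (v - c)
     = memory (x - v * t - x0) v s.
  apply: eq_Rintegral => y _; rewrite /profile; congr (_ * phi _); ring.
by ring.
Qed.

Let memory_deriv (x v s : R) : -1 < s -> is_derive s (1 : R) (memory x v)
  (profile x v s - expR (- S) * profile x v (s - S) - memory x v s).
Proof. by move=> s1; exact: (cut_memory_derive (@profile_cont x v) (ltW S_gt0) s1). Qed.

Let memory_cont (x v s : R) : -1 < s -> {for s, continuous (memory x v)}.
Proof. by move=> s1; exact: is_derive_continuous (memory_deriv x v s1). Qed.

Let src_char (t x v s : R) : src s (x - v * (t - s)) v =
  r * (eta * (b * M v) * memory (x - v * t - x0) v s) +
  eta * (b * M v) * profile (x - v * t - x0) v s.
Proof. by rewrite /src p_char frame_char /profile; ring. Qed.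

Let src_int (t x v : R) : 0 <= t -> mu.-integrable `[0, t]
  (EFin \o (fun s => expR (- ((1 + r) * (t - s))) * src s (x - v * (t - s)) v)).
Proof.
move=> t0; apply: continuous_compact_integrable; first exact: segment_compact.
apply: continuous_in_subspaceT => s; rewrite inE /= in_itv/= => /andP[s0 st].
have -> : (fun s => expR (- ((1 + r) * (t - s))) * src s (x - v * (t - s)) v) =
  (fun s => expR (- ((1 + r) * t) + (1 + r) * s) *
    (r * (eta * (b * M v) * memory (x - v * t - x0) v s) +
     eta * (b * M v) * profile (x - v * t - x0) v s)).
  by apply/funext => u; rewrite src_char; congr (expR _ * _); ring.
apply: cvgM; first exact: continuous_expR_affine.
apply: cvgD; (apply: cvgM; first exact: cvg_cst); last exact: profile_cont.
apply: cvgM; first exact: cvg_cst.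
by apply: memory_cont; apply: lt_le_trans s0; rewrite ltrN10.
Qed.

Lemma shifted_wave_le t x v : 0 <= t -> V v -> p t x v <= g t x v.
Proof.
have C0 : 0 <= 1 + 2 * r by have := r_gt0; lra.
apply: (comparison C0 (p := p) (src := src)) => //.
- move=> {}t {}x {}v t0 Vv; apply: le_trans (p_le t x Vv) _.
  rewrite ler_piMl ?M_ge0//; apply: le_trans eta_gam _.
  by have /andP[_ /ltW] := gam_range.
- move=> {}x {}v Vv; have [xx|xx] := lerP x xL.
    apply: le_trans (p_le 0 x Vv) _; apply: le_trans (g0_ge xx Vv).
    by rewrite ler_wpM2r ?M_ge0.
  rewrite /p H_eq0 ?mulr0 ?mulr0 ?g0_ge0//.
  by have := x0_le; move: xx; rewrite subr0; lra.
- by move=> {}t {}x {}v t0 Vv; exact: src_int.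
- move=> {}t {}x {}v t0 Vv.
  set y0 := x - v * t - x0.
  pose K := eta * (b * M v).
  have K0 : 0 <= K by rewrite !mulr_ge0 ?M_ge0// ltW.
  have neg1 s : 0 <= s <= t -> -1 < s.
    by move=> /andP[s0 _]; apply: lt_le_trans s0; rewrite ltrN10.
  have := @le_duhamel _ (1 + r) t (fun s => K * memory y0 v s)
    (fun s => K * (profile y0 v s - expR (- S) * profile y0 v (s - S) - memory y0 v s))
    (fun s => src s (x - v * (t - s)) v) t0.
  have -> : p t x v = K * memory y0 v t.
    by rewrite -p_char subrr mulr0 subr0.
  have -> : p 0 (x - v * t) v = K * memory y0 v 0.
    by rewrite -p_char subr0.
  apply.
  + move=> s st; have d := memory_deriv y0 v (neg1 s st).
    exact: (@is_deriveZ _ _ _ (memory y0 v) K s 1 _ d).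
  + move=> s st; apply: cvgM; first exact: cvg_cst.
    apply: cvgB; last exact: (@memory_cont y0 v s (neg1 s st)).
    apply: cvgB; first exact: profile_cont.
    apply: cvgM; first exact: cvg_cst.
    apply: (@continuous_comp _ _ _ (fun u : R => u - S) (profile y0 v));
      last exact: profile_cont.
    by apply: cvgB; [exact: cvg_id|exact: cvg_cst].
  + exact: src_int.
  + move=> s st; rewrite src_char -/y0 -/K.
    have := mulr_ge0 K0 (mulr_ge0 (expR_ge0 (- S)) (_ : 0 <= profile y0 v (s - S))).
    have /andP[f0 _] := phiB (y0 + (v - c) * (s - S)).
    by move=> /(_ f0); lra.
Qed.

End Shifted.

(** At time [t] and position [x], use the translate of the wave whose centre is
    at [x]; it started at [x - c * t]. *)
Lemma invasion_lower_bound : exists eta X0 : R, 0 < eta /\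
  forall t x v, 0 <= t -> V v -> x <= c * t + X0 -> eta * M v <= g t x v.
Proof.
have /andP[gam0 gam1] := gam_range.
have /andP[b1 br] := b_range.
have r0 := r_gt0.
have K0 : 0 <= b * B * S by rewrite !mulr_ge0// ltW.
have B0 := B_ge0.
have b0 := b_ge0.
pose Den := b * B * S + B + 1.
have D0 : 0 < Den by rewrite /Den; lra.
pose eta := Num.min gam ((1 + r - b) / r) / Den.
have eta0 : 0 < eta.
  by rewrite divr_gt0// lt_min gam0/= divr_gt0// subr_gt0.
have etaD : eta * Den <= gam /\ eta * Den <= (1 + r - b) / r.
  by rewrite /eta divfK ?gt_eqF// !ge_min !lexx/= orbT.
have etaK : eta * (b * B * S) <= eta * Den.
  by rewrite ler_pM2l// /Den; lra.
have etaB : eta * B <= eta * Den by rewrite ler_pM2l// /Den; lra.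
have [D1 D2] := etaD.
exists (eta * (b * (phi0 * expR (- S) * S))), (xL - L - W * S); split.
  apply: mulr_gt0 => //; apply: mulr_gt0; first exact: lt_le_trans b1.
  by rewrite !mulr_gt0 ?expR_gt0.
move=> t x v t0 Vv xx.
have h1 : r * (eta * (b * B * S)) <= 1 + r - b.
  by rewrite mulrC -ler_pdivlMr//; apply: le_trans D2.
have h2 : eta * B <= 1 by lra.
have h3 : eta * (b * B * S) <= gam by lra.
have h4 : x - c * t + L + W * S <= xL by lra.
apply: le_trans (shifted_wave_le eta0 h3 h1 h2 h4 x t0 Vv).
rewrite subrr -[leLHS]mulrA ler_pM2l// [leLHS]mulrC ler_wpM2l ?M_ge0//.
exact: H_core.
Qed.

End Invasion.

(** * Relaxation to [M] behind the front *)

Section Relaxation.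
Variables (c W eta X0 : R).
Hypothesis W_bound : forall v, V v -> `|v - c| <= W.
Hypothesis eta_gt0 : 0 < eta.
Hypothesis g0_ge0 : forall x v, V v -> 0 <= g0 x v.
Hypothesis g_ge : forall t x v, 0 <= t -> V v -> x <= c * t + X0 -> eta * M v <= g t x v.

Let rho_ge t x : 0 <= t -> x <= c * t + X0 -> eta <= rho V g t x.
Proof.
move=> t0 xx; have -> : eta = \int[mu]_(v in V) (eta * M v).
  by rewrite RintegralZl ?M_Rint ?mulr1//; exact: M_integrable.
apply: le_Rintegral => //.
- by apply: integrable_scale => //; exact: M_integrable.
- exact: g_integrable.
- by move=> v Vv; exact: g_ge.
Qed.

Section Barrier.
Variables (delta m : R).
Hypothesis delta_gt0 : 0 < delta.
Hypothesis delta_r : delta <= r * eta.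
Hypothesis delta_half : delta <= (1 + r) / 2.
Hypothesis m_ge0 : 0 <= m.
Hypothesis m_W : m * W <= delta.

(** Upper bound for the relative defect [1 - g / M].  The factor 2 makes it
    dominate with a margin where [g >= eta * M] is not known. *)
Let z (t x : R) : R := expR (- (delta * t)) + 2 * expR (m * (x - c * t - X0)).
Let p (t x v : R) : R := M v * (1 - z t x).
Let src (t x v : R) : R := M v * ((1 + r) - (1 + r - delta) * z t x).

Let z_ge0 t x : 0 <= z t x.
Proof. by rewrite addr_ge0 ?mulr_ge0 ?expR_ge0. Qed.

Let step (t e : R) : 0 <= t -> 0 <= e ->
  (forall x v, V v -> p t x v <= g t x v + M v * e) ->
  forall x v, V v -> src t x v <= gain t x v + (1 + r) * (M v * e).
Proof.
move=> t0 e0 pg x v Vv.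
have rho_z : 1 - rho V g t x <= z t x + e.
  have -> : 1 - rho V g t x = \int[mu]_(w in V) (M w - g t x w).
    by rewrite RintegralB ?M_Rint//; [exact: M_integrable|exact: g_integrable].
  have -> : z t x + e = \int[mu]_(w in V) ((z t x + e) * M w).
    by rewrite RintegralZl ?M_Rint ?mulr1//; exact: M_integrable.
  apply: le_Rintegral => //.
  - have h := integrable_scale (-1) V_meas (g_integrable x t0).
    have := integrable_add V_meas M_integrable h.
    by apply: eq_integrable => // w _ /=; rewrite mulN1r.
  - by apply: integrable_scale => //; exact: M_integrable.
  - by move=> w Vw; have := pg x w Vw; rewrite /p; lra.
have Mv := M_ge0 Vv.
have pgv := pg x v Vv.
have gM := g_leM x t0 Vv.
have G0 := g_ge0 x t0 Vv.
have rho0 := rho_ge0 x t0.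
have rho1 := rho_le1 x t0.
have zge := z_ge0 t x.
have r0 := r_gt0.
(* Either saturation damps the defect at rate [r * eta], or the barrier exceeds
   twice the trivial bound 1 on the defect. *)
have cases : eta <= rho V g t x \/ 2 <= z t x.
  have [xx|xx] := lerP x (c * t + X0); first by left; exact: rho_ge.
  right; rewrite /z; apply: ler_wpDl; first exact: expR_ge0.
  rewrite ler_peMr// -expR0 ler_expR mulr_ge0//; lra.
have dr := delta_r. have dh := delta_half. have d0 := delta_gt0.
move: rho_z pgv cases; rewrite /src /gain /p.
move: (g t x v) (rho V g t x) (z t x) (M v) zge Mv gM G0 rho0 rho1.
move=> G rh Z A Z0 A0 GA G0 rh0 rh1 rhZ pgv cases.
suff : r * (1 - rh) * (A - G) + A * (1 - rh) <= A * ((1 + r - delta) * Z) + (1 + r) * (A * e).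
  lra.
have q0 : 0 <= 1 - rh by lra.
have AG : A - G <= A * (Z + e) by lra.
have Ae : 0 <= A * e by rewrite mulr_ge0.
have AZ : 0 <= A * Z by rewrite mulr_ge0.
have h2 : A * (1 - rh) <= A * (Z + e) by rewrite ler_wpM2l.
have [c1|c2] := cases.
  have h1 : r * (1 - rh) * (A - G) <= r * (1 - eta) * (A * (Z + e)).
    apply: ler_pM => //; first by rewrite mulr_ge0// ltW.
      by rewrite subr_ge0.
    by rewrite ler_pM2l// lerD2l lerN2.
  have h3 : delta * (A * Z) <= r * eta * (A * Z) by rewrite ler_wpM2r.
  have h4 : 0 <= r * eta * (A * e) by rewrite mulr_ge0// mulr_ge0// ltW.
  lra.
have h1 : r * (1 - rh) * (A - G) <= r * A.
  rewrite -mulrA ler_pM2l//.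
  have : (1 - rh) * (A - G) <= 1 * A by apply: ler_pM => //; lra.
  by rewrite mul1r.
have h3 : A * (1 - rh) <= A by rewrite ler_piMr//; lra.
have h4 : A * ((1 + r - delta) * 2) <= A * ((1 + r - delta) * Z).
  by rewrite ler_wpM2l// ler_wpM2l//; lra.
have h5 : A * (1 + r) <= A * ((1 + r - delta) * 2) by rewrite ler_wpM2l//; lra.
have h6 : 0 <= (1 + r) * (A * e) by rewrite mulr_ge0//; lra.
lra.
Qed.

Let zc (x v s : R) : R := expR (0 + (- delta) * s) +
  2 * expR (m * (x - X0) + (m * (v - c)) * s).
Let dzc (x v s : R) : R := (- delta) * expR (0 + (- delta) * s) +
  2 * ((m * (v - c)) * expR (m * (x - X0) + (m * (v - c)) * s)).

Let z_char (t x v s : R) : z s (x - v * (t - s)) = zc (x - v * t) v s.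
Proof.
by rewrite /z /zc; congr (expR _ + _ * expR _); ring.
Qed.

Let zc_deriv (x v s : R) : is_derive s (1 : R) (zc x v) (dzc x v s).
Proof.
have d1 := is_derive_expR_affine 0 (- delta) s.
have d2 := is_derive_expR_affine (m * (x - X0)) (m * (v - c)) s.
have d3 := @is_deriveZ _ _ _ _ 2 s 1 _ d2.
exact: is_deriveD d1 d3.
Qed.

Let zc_cont (x v : R) : continuous (zc x v).
Proof. by move=> s; exact: is_derive_continuous (zc_deriv x v s). Qed.

Lemma barrier_le t x v : 0 <= t -> V v -> p t x v <= g t x v.
Proof.
have r0 := r_gt0.
have C0 : 0 <= 1 + r by lra.
have isrc (t' x' v' : R) : mu.-integrable `[0, t']
    (EFin \o (fun s => expR (- ((1 + r) * (t' - s))) * src s (x' - v' * (t' - s)) v')).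
  have -> : (fun s => expR (- ((1 + r) * (t' - s))) * src s (x' - v' * (t' - s)) v') =
    (fun s => expR (- ((1 + r) * t') + (1 + r) * s) *
      (M v' * ((1 + r) - (1 + r - delta) * zc (x' - v' * t') v' s))).
    by apply/funext => s; rewrite /src z_char; congr (expR _ * _); ring.
  apply: continuous_itv_integrable => s.
  apply: cvgM; first exact: continuous_expR_affine.
  apply: cvgM; first exact: cvg_cst.
  apply: cvgB; first exact: cvg_cst.
  by apply: cvgM; [exact: cvg_cst|exact: zc_cont].
apply: (comparison C0 (p := p) (src := src)) => //.
- move=> {}t {}x {}v t0 Vv; rewrite /p ler_piMr ?M_ge0//.
  by have := z_ge0 t x; lra.
- move=> {}x {}v Vv; apply: le_trans (g0_ge0 x Vv).
  rewrite /p mulr_ge0_le0 ?M_ge0// /z mulr0 oppr0 expR0.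
  by have := expR_ge0 (m * (x - c * 0 - X0)); lra.
- move=> {}t {}x {}v t0 Vv.
  have Mv := M_ge0 Vv.
  have := @le_duhamel _ (1 + r) t (fun s => M v * (1 - zc (x - v * t) v s))
    (fun s => M v * (0 - dzc (x - v * t) v s))
    (fun s => src s (x - v * (t - s)) v) t0.
  have -> : p t x v = M v * (1 - zc (x - v * t) v t).
    by rewrite -z_char subrr mulr0 subr0.
  have -> : p 0 (x - v * t) v = M v * (1 - zc (x - v * t) v 0).
    by rewrite -z_char subr0 /p; congr (_ * (1 - z _ _)); ring.
  apply.
  + move=> s _; have d1 := is_deriveB (is_derive_cst (1 : R) s 1) (zc_deriv (x - v * t) v s).
    exact: (@is_deriveZ _ _ _ _ (M v) s 1 _ d1).
  + move=> s _; apply: cvgM; first exact: cvg_cst.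
    apply: cvgB; first exact: cvg_cst.
    apply: cvgD; first by apply: cvgM; [exact: cvg_cst|exact: continuous_expR_affine].
    apply: cvgM; first exact: cvg_cst.
    by apply: cvgM; [exact: cvg_cst|exact: continuous_expR_affine].
  + exact: isrc.
  + move=> s st; rewrite /src z_char.
    have -> : (1 + r) * (M v * (1 - zc (x - v * t) v s)) + M v * (0 - dzc (x - v * t) v s)
      = M v * ((1 + r) * (1 - zc (x - v * t) v s) - dzc (x - v * t) v s) by ring.
    rewrite ler_wpM2l// /zc /dzc.
    set E1 := expR _; set E2 := expR _.
    have E20 : 0 <= E2 by exact: expR_ge0.
    have h : - delta <= m * (v - c).
      rewrite lerNl -mulrN; apply: le_trans m_W; rewrite ler_wpM2l//.
      by apply: le_trans (W_bound Vv); rewrite -normrN ler_norm.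
    have : - delta * E2 <= m * (v - c) * E2 by rewrite ler_wpM2r.
    lra.
Qed.

End Barrier.

Lemma relaxation_lower_bound : exists delta m : R, [/\ 0 < delta, 0 < m &
  forall t x v, 0 <= t -> V v ->
    M v * (1 - (expR (- (delta * t)) + 2 * expR (m * (x - c * t - X0)))) <= g t x v].
Proof.
have r0 := r_gt0.
have e0 := eta_gt0.
pose delta := Num.min (r * eta) ((1 + r) / 2).
have d0 : 0 < delta by rewrite lt_min mulr_gt0//= divr_gt0// addr_gt0.
have d1 : delta <= r * eta by rewrite ge_min lexx.
have d2 : delta <= (1 + r) / 2 by rewrite ge_min lexx orbT.
pose D := `|W| + 1.
have D0 : 0 < D by rewrite ltr_wpDl.
exists delta, (delta / D); split => //; first by rewrite divr_gt0.
move=> t x v t0 Vv; apply: barrier_le => //; first by rewrite ltW// divr_gt0.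
rewrite mulrAC ler_pdivrMr// ler_pM2l//.
by apply: le_trans (ler_norm W) _; rewrite lerDl.
Qed.

End Relaxation.

End Solution.

(** * The dispersion relation below the minimal speed *)

Section Velocities.
Variables (R : realType) (r : R) (V : set R) (M : R -> R).
Notation mu := (@lebesgue_measure R).
Hypothesis r_gt0 : 0 < r.
Hypothesis V_compact : compact V.
Hypothesis V_sym : [set - v | v in V] = V.
Hypothesis V_supp : V = density_supp V M.
Hypothesis M_cont : {within V, continuous M}.
Hypothesis M_ge0 : forall v, V v -> 0 <= M v.
Hypothesis M_mass : (\int[mu]_(v in V) (M v)%:E = 1%E)%E.
Hypothesis M_mean : (\int[mu]_(v in V) (v * M v)%:E = 0%E)%E.

Let vm := sup V.

Lemma velocities_measurable : measurable V.
Proof. exact: compact_measurable. Qed.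
Let mV := velocities_measurable.

Lemma density_measurable : measurable_fun V M.
Proof. by apply: subspace_continuous_measurable_fun. Qed.

Let iM : mu.-integrable V (EFin \o M) := M_integrable density_measurable M_ge0 M_mass.

Lemma velocities_max : V vm /\ forall v, V v -> v <= vm.
Proof.
have V0 : V !=set0.
  apply/set0P/eqP => VE; move: M_mass; rewrite VE integral_set0 => /eqP.
  by rewrite eqe eq_sym oner_eq0.
have [|v1 v1V v1max] := @compact_EVT_max R R id V V0 V_compact.
  by apply: continuous_subspaceT => x; exact: cvg_id.
have {}v1V : V v1 by rewrite inE in v1V.
have v1m v : V v -> v <= v1 by move=> Vv; apply: v1max; rewrite inE.
have -> : vm = v1.
  apply/eqP; rewrite eq_le; apply/andP; split.
    by apply: ge_sup.
  by apply: ub_le_sup => //; exists v1 => v /v1m.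
by split.
Qed.

Lemma velocities_bound v : V v -> `|v| <= vm.
Proof.
move=> Vv; have [_ h] := velocities_max.
rewrite ler_norml h// andbT lerNl; apply: h.
by rewrite -V_sym; exists v.
Qed.

Lemma mass_near_gt0 v0 e : V v0 -> 0 < e ->
  mu.-integrable V (EFin \o (fun v => M v * \1_(ball v0 e) v)) /\
  0 < \int[mu]_(v in V) (M v * \1_(ball v0 e) v).
Proof.
move=> Vv0 e0.
have i1 : mu.-integrable V (EFin \o (fun v => M v * \1_(ball v0 e) v)).
  apply: (@integrable_mul_bounded _ _ _ _ 1) => //.
    by apply: measurable_indic; exact: measurable_ball.
  by move=> v _; rewrite indicE; case: (_ \in _); rewrite ?normr0 ?normr1.
split => //.
have := Vv0; rewrite {1}V_supp => /(_ e e0).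
rewrite integral_mkcondr.
have -> : (\int[mu]_(v in V) ((fun w => (M w)%:E) \_ (ball v0 e)) v =
   \int[mu]_(v in V) (M v * \1_(ball v0 e) v)%:E)%E.
  apply: eq_integral => v _; rewrite patchE indicE.
  by case: (_ \in _); rewrite ?mulr1 ?mulr0.
by rewrite -lte_fin EFin_Rintegral.
Qed.

Lemma mean_zero : \int[mu]_(v in V) (M v * v) = 0.
Proof.
rewrite /Rintegral; under eq_integral do rewrite mulrC.
by rewrite M_mean.
Qed.

Lemma momentum_integrable : mu.-integrable V (EFin \o (fun v => M v * v)).
Proof.
apply: (@integrable_mul_bounded _ _ _ _ vm) => //.
exact: velocities_bound.
Qed.

Section Speed.
Variable c : R.
Hypothesis c_gt0 : 0 < c.
Hypothesis c_lt : c < vm.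

Let W := vm + c.
Let vm_gt0 : 0 < vm. Proof. exact: lt_trans c_lt. Qed.

Lemma relative_speed_bound v : V v -> `|v - c| <= W.
Proof.
move=> Vv; apply: le_trans (ler_normB _ _) _.
by rewrite (gtr0_norm c_gt0) lerD2r velocities_bound.
Qed.

Let J := jump V M c.

(** The velocities have mean 0, hence the relative velocities have mean [- c]. *)
Lemma jump_id_lt0 S : 0 < S -> J S id < 0.
Proof.
move=> S0; rewrite /J /jump.
have -> : \int[mu]_(v in V) (M v * flight S id (v - c)) =
   \int[mu]_(v in V) (flight_mean S * (M v * v) - flight_mean S * c * M v).
  by apply: eq_Rintegral => v _; rewrite flight_id; ring.
rewrite RintegralB//; last 2 first.
- by apply: integrable_scale => //; exact: momentum_integrable.
- exact: integrable_scale.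
rewrite RintegralZl//; last exact: momentum_integrable.
rewrite RintegralZl// mean_zero mulr0 sub0r oppr_lt0.
by rewrite /Rintegral M_mass mulr1 mulr_gt0// flight_mean_gt0.
Qed.

(** Velocities close to [sup V > c] carry positive mass. *)
Lemma jump_pos_gt0 S : 0 < S -> 0 < J S (@pos R).
Proof.
move=> S0.
have [Vm vmax] := velocities_max.
pose e := (vm - c) / 2.
have e0 : 0 < e by rewrite divr_gt0// subr_gt0.
have [i1 p0] := mass_near_gt0 Vm e0.
have J0 := flight_mean_gt0 S0.
apply: (@lt_le_trans _ _ (flight_mean S * e *
  \int[mu]_(v in V) (M v * \1_(ball vm e) v))).
  by apply: mulr_gt0 => //; exact: mulr_gt0.
rewrite -RintegralZl// /J /jump; apply: le_Rintegral => //.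
- exact: integrable_scale.
- apply: (jump_integrable mV iM relative_speed_bound (ltW S0)).
  exact: (continuous_pos (@continuous_idf R)).
- move=> v Vv; rewrite flight_pos indicE.
  have Mv := M_ge0 Vv.
  have [h|h] := pselect (ball vm e v); last first.
    by rewrite memNset// !mulr0 !mulr_ge0 ?pos_ge0// ltW.
  rewrite mem_set//; move: h; rewrite /ball /= => h.
  have ev : e <= v - c.
    have : vm - v < e by apply: le_lt_trans h; exact: ler_norm.
    by rewrite /e; lra.
  have := pos_ge (v - c) => h2.
  rewrite mulr1 [leLHS]mulrC ler_wpM2l// ler_wpM2l ?(ltW J0)//.
  exact: le_trans h2.
Qed.

Let J_le (S : R) (f g : R -> R) : 0 <= S -> continuous f -> continuous g ->
  (forall z, `|z| <= W * S -> f z <= g z) -> J S f <= J S g.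
Proof. exact: (jump_le mV iM M_ge0 relative_speed_bound). Qed.

Let J_add (S : R) (f g : R -> R) : 0 <= S -> continuous f -> continuous g ->
  J S (fun z => f z + g z) = J S f + J S g.
Proof. exact: (jump_add mV iM relative_speed_bound). Qed.

Let J_scale (S k : R) (f : R -> R) : 0 <= S -> continuous f ->
  J S (fun z => k * f z) = k * J S f.
Proof. exact: (jump_scale mV iM relative_speed_bound). Qed.

(** Rates smaller than [1 + r], so as to leave room for the saturation term of
    small solutions; along the same sequence flights are cut at [n + 1]. *)
Definition reduced_rate (n : nat) : R := 1 + r - r / n.+2%:R.

Lemma reduced_rate_ge1 n : 1 <= reduced_rate n.
Proof.
rewrite /reduced_rate -addrA lerDl subr_ge0 ler_piMr ?(ltW r_gt0)//.
by rewrite invf_le1// ler1n.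
Qed.

Lemma reduced_rate_lt n : reduced_rate n < 1 + r.
Proof. by rewrite /reduced_rate gtrBl divr_gt0. Qed.

Lemma reduced_rate_mono m n : (m <= n)%N -> reduced_rate m <= reduced_rate n.
Proof.
move=> mn; rewrite /reduced_rate lerD2l lerN2 ler_wpM2l ?(ltW r_gt0)//.
by rewrite lef_pV2 ?posrE// ler_nat !ltnS.
Qed.

Lemma reduced_rate_cvg : reduced_rate n @[n --> \oo] --> 1 + r.
Proof.
rewrite -[X in _ --> X]subr0; apply: cvgB; first exact: cvg_cst.
rewrite -(mulr0 r); apply: cvgM; first exact: cvg_cst.
apply: (cvg_comp (fun n => n.+1) (@harmonic R)); last exact: cvg_harmonic.
by under eq_fun do rewrite -addn1; exact: cvg_addnr.
Qed.

Let T (n : nat) (f : R -> R) : R := reduced_rate n * J n.+1%:R f.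
Let e_ (lam : R) : R -> R := fun z => expR (lam * z).

Let Tmono m n (f : R -> R) : (m <= n)%N -> continuous f -> (forall z, 0 <= f z) ->
  T m f <= T n f.
Proof.
move=> mn cf f0; apply: ler_pM.
- by rewrite (le_trans ler01)// reduced_rate_ge1.
- apply: Rintegral_ge0 => v Vv; rewrite mulr_ge0 ?M_ge0//.
  by apply: Rintegral_ge0 => s _; rewrite mulr_ge0// expR_ge0.
- exact: reduced_rate_mono.
- by apply: (jump_mono mV iM M_ge0 relative_speed_bound) => //; rewrite ler_nat.
Qed.

Let T_le n (f g : R -> R) : continuous f -> continuous g ->
  (forall z, `|z| <= W * n.+1%:R -> f z <= g z) -> T n f <= T n g.
Proof.
move=> cf cg fg; rewrite /T; apply: ler_wpM2l; last first.
  by apply: J_le; [exact: ler0n|exact: cf|exact: cg|exact: fg].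
by apply: le_trans ler01 _; exact: reduced_rate_ge1.
Qed.

Let T_add n (f g : R -> R) : continuous f -> continuous g ->
  T n (fun z => f z + g z) = T n f + T n g.
Proof. by move=> cf cg; rewrite /T J_add// mulrDr. Qed.

Let T_scale n (k : R) (f : R -> R) : continuous f -> T n (fun z => k * f z) = k * T n f.
Proof. by move=> cf; rewrite /T J_scale// mulrCA. Qed.

Let T_pos n : 0 < T n (@pos R).
Proof. by rewrite /T mulr_gt0 ?jump_pos_gt0// (lt_le_trans ltr01)// reduced_rate_ge1. Qed.

Let W_ge0 n : 0 <= W * n.+1%:R.
Proof. by rewrite mulr_ge0// addr_ge0// ltW. Qed.

(** The bound [lam * T n pos <= T n (exp (lam z))] confines the given tilts to a
    compact interval.  For each [k], the cluster point [l] is a limit of tilts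
    taken from [T n] with [n >= k], and [T n] dominates [T k]. *)
Lemma common_tilt : (forall n, exists2 lam, 0 <= lam & T n (e_ lam) <= 1) ->
  exists2 l, 0 <= l & forall k, T k (e_ l) <= 1.
Proof.
move=> /(_ _)/cid2-/all_sig2[lam lam0 Tlam].
have lamB n : lam n <= (T 0 (@pos R))^-1.
  rewrite -[leRHS]mul1r ler_pdivlMr//.
  have cp := continuous_pos (@continuous_idf R).
  apply: (@le_trans _ _ (lam n * T n (@pos R))).
    apply: ler_wpM2l; first exact: lam0.
    by apply: Tmono; [exact: leq0n|exact: cp|exact: pos_ge0].
  apply: le_trans (Tlam n).
  exact: (T_exp_ge (@T_le n) (@T_scale n) (lam0 n)).
have [|h hinc /cvg_ex[l hl]] := @bolzano_weierstrass R lam.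
  exists (T 0 (@pos R))^-1; split; first exact: num_real.
  by move=> y hy n _ /=; rewrite ger0_norm// (le_trans (lamB n))// ltW.
have cT k : continuous (fun x : R => T k (e_ x)).
  have := T_exp_continuous (@T_le k) (@T_add k) (@T_scale k)
     (@continuous_cstf R 1).
  have -> : (fun lam0 : R => T k (fun z => 1 * expR (lam0 * z))) =
            (fun x : R => T k (e_ x)).
    by apply/funext => x; congr (T k); apply/funext => z; rewrite mul1r.
  by [].
have hn n : (n <= h n)%N.
  elim: n => // n IH; apply: leq_ltn_trans IH _.
  have := hinc n.+1 n; rewrite !leEnat ltnn => /negbT.
  by rewrite -ltnNge.
exists l.
  rewrite -(cvg_lim _ hl)//; apply: limr_ge; first by apply/cvg_ex; exists l.
  by apply: nearW => n; exact: lam0.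
move=> k.
have hT : T k (e_ (lam (h n))) @[n --> \oo] --> T k (e_ l).
  apply: (@continuous_cvg _ _ _ _ _ (lam \o h) (fun x : R => T k (e_ x)) l) => //.
  exact: cT.
rewrite -(cvg_lim _ hT)//; apply: limr_le; first by apply/cvg_ex; exists (T k (e_ l)).
near=> n.
have kn : (k <= h n)%N.
  by apply: leq_trans (hn n); near: n; exact: nbhs_infty_ge.
apply: le_trans (Tlam (h n)); apply: Tmono.
- exact: kn.
- exact: continuous_expRZ.
- by move=> z; exact: expR_ge0.
Unshelve. all: by end_near. Qed.

Lemma flight_exp S l w : 0 <= S -> 1 - l * w != 0 ->
  flight S (e_ l) w = (1 - expR (- ((1 - l * w) * S))) / (1 - l * w).
Proof.
move=> S0 k0; rewrite /flight; set kap := 1 - l * w in k0 *.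
have -> : \int[mu]_(s in `[0, S]) (expR (- s) * e_ l (w * s)) =
   (- kap)^-1 * \int[mu]_(s in `[0, S]) ((- kap) * expR (0 + (- kap) * s)).
  rewrite -RintegralZl//; last first.
    apply: continuous_itv_integrable; apply: continuousMf.
      exact: continuous_cstf.
    exact: continuous_expR_affine.
  apply: eq_Rintegral => s _; rewrite mulKf ?oppr_eq0// /e_ -expRD.
  by congr expR; rewrite /kap; ring.
rewrite Rint_expR_affine// expR0 add0r mulNr invrN.
by rewrite mulNr -mulrN opprB mulrC.
Qed.

(** Otherwise [exp (- s + l * (v - c) * s) >= 1] for all velocities [v] close to
    [sup V], and their contribution grows linearly with the cut. *)
Lemma tilt_range l : 0 <= l -> (forall k, T k (e_ l) <= 1) -> l * (vm - c) <= 1.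
Proof.
move=> l0 Tl; rewrite leNgt; apply/negP => lvc.
have [Vm vmax] := velocities_max.
have vc0 : 0 < vm - c by rewrite subr_gt0.
have l1 : 0 < l.
  rewrite lt_neqAle l0 andbT; apply/negP => /eqP l00.
  by move: lvc; rewrite -l00 mul0r ltr10.
pose e := vm - c - l^-1.
have e0 : 0 < e by rewrite subr_gt0 -[ltLHS]mul1r ltr_pdivrMr// mulrC.
have [i1 p0] := mass_near_gt0 Vm e0.
set p := Rintegral _ _ _ in p0.
have ce : continuous (e_ l) by exact: continuous_expRZ.
have Sp k : k.+1%:R * p <= 1.
  apply: le_trans (Tl k); rewrite /T.
  apply: (@le_trans _ _ (J k.+1%:R (e_ l))); last first.
    rewrite ler_peMl ?reduced_rate_ge1// Rintegral_ge0// => v Vv.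
    rewrite mulr_ge0 ?M_ge0//.
    by apply: Rintegral_ge0 => s _; rewrite mulr_ge0// expR_ge0.
  rewrite /p -RintegralZl//; apply: le_Rintegral => //.
  - exact: integrable_scale.
  - exact: (jump_integrable mV iM relative_speed_bound).
  move=> v Vv; rewrite indicE.
  have Mv := M_ge0 Vv.
  have [h|h] := pselect (ball vm e v); last first.
    rewrite memNset// !mulr0 mulr_ge0//.
    by apply: Rintegral_ge0 => s _; rewrite mulr_ge0// expR_ge0.
  rewrite mem_set//; move: h; rewrite /ball /= => h.
  rewrite mulr1 mulrC ler_wpM2l//.
  have vl : 1 <= l * (v - c).
    have : vm - v < e by apply: le_lt_trans h; exact: ler_norm.
    rewrite -(mulfV (lt0r_neq0 l1)) ler_pM2l// /e; lra.
  rewrite -[leLHS]mul1r -[X in _ * X <= _]subr0 -Rint_cst//.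
  apply: le_Rintegral => //.
  - by apply: continuous_itv_integrable; exact: continuous_cstf.
  - exact: flight_integrable.
  move=> s; rewrite /= in_itv/= => /andP[s0 sS].
  rewrite /e_ -expRD -[leLHS]expR0 ler_expR.
  have := mulr_ge0 s0 (_ : 0 <= l * (v - c) - 1).
  by rewrite subr_ge0 => /(_ vl); lra.
have := Sp (Num.truncn (p^-1)).
apply/negP; rewrite -ltNge -ltr_pdivrMr// mul1r; exact: truncnS_gt.
Qed.

Section Tilt.
Variable l : R.
Hypothesis l_ge0 : 0 <= l.
Hypothesis l_range : l * (vm - c) <= 1.

Lemma kappa_gt0 v : V v -> v != vm -> 0 < 1 - l * (v - c).
Proof.
move=> Vv vvm; have [_ vmax] := velocities_max.
have vlt : v < vm by rewrite lt_neqAle vvm vmax.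
have := l_ge0; rewrite le_eqVlt => /predU1P[<-|l0].
  by rewrite mul0r subr0.
rewrite subr_gt0; apply: lt_le_trans l_range.
by rewrite ltr_pM2l// ltrD2r.
Qed.

Lemma kappa_ge0 v : V v -> 0 <= 1 - l * (v - c).
Proof.
move=> Vv; have [->|vvm] := eqVneq v vm; first by rewrite subr_ge0.
by rewrite ltW// kappa_gt0.
Qed.

Lemma measurable_profile : measurable_fun V (fun v => M v / (1 - l * (v - c))).
Proof.
have mk : measurable_fun V (fun v => 1 - l * (v - c)).
  apply: measurable_funTS; apply: continuous_measurable_fun => v.
  apply: cvgB; first exact: cvg_cst.
  by apply: cvgM; [exact: cvg_cst|apply: cvgB; [exact: cvg_id|exact: cvg_cst]].
apply: measurable_funM; first exact: density_measurable.
by apply: measurableT_comp => //; exact: measurable_inv.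
Qed.

(** Monotone convergence as the flights are no longer cut. *)
Lemma dispersion_integral_le1 : (forall k, T k (e_ l) <= 1) ->
  (\int[mu]_(v in V) ((1 + r) * (M v / (1 - l * (v - c))))%:E <= 1)%E.
Proof.
move=> Tl.
have ce : continuous (e_ l) by exact: continuous_expRZ.
have mP : measurable_fun V (fun v => (1 + r) * (M v / (1 - l * (v - c)))).
  by apply: measurable_funM => //; exact: measurable_profile.
have mVm : measurable (V `\ vm) by exact: measurableD.
rewrite -(@integral_setD1 _ _ vm)//; last first.
  apply/measurable_EFinP; apply: measurable_funS mP => //; exact: subDsetl.
pose F n v := (reduced_rate n * (M v * flight n.+1%:R (e_ l) (v - c)))%:E.
have iF n : mu.-integrable V (F n).
  apply: integrable_scale => //.
  exact: (jump_integrable mV iM relative_speed_bound).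
have fl0 n v : 0 <= flight n.+1%:R (e_ l) (v - c).
  by apply: Rintegral_ge0 => s _; rewrite mulr_ge0// expR_ge0.
have F0 n v : V v -> (0 <= F n v)%E.
  move=> Vv; rewrite lee_fin !mulr_ge0 ?M_ge0//.
  by rewrite (le_trans ler01)// reduced_rate_ge1.
have Fcvg v : (V `\ vm) v -> F n v @[n --> \oo] -->
    ((1 + r) * (M v / (1 - l * (v - c))))%:E.
  move=> [Vv /eqP vvm]; apply: cvg_EFin; first exact: nearW.
  have k0 := kappa_gt0 Vv vvm.
  apply: cvgM; first exact: reduced_rate_cvg.
  apply: cvgM; first exact: cvg_cst.
  have -> : (fun n => flight n.+1%:R (e_ l) (v - c)) =
    (fun n => (1 - expR (- ((1 - l * (v - c)) * n.+1%:R))) / (1 - l * (v - c))).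
    by apply/funext => n; rewrite flight_exp// gt_eqF.
  rewrite -[X in _ --> X]mul1r; apply: cvgM; last exact: cvg_cst.
  rewrite -[X in _ --> X]subr0; apply: cvgB; first exact: cvg_cst.
  exact: expR_mulrn_cvg0.
have -> : (\int[mu]_(v in V `\ vm) ((1 + r) * (M v / (1 - l * (v - c))))%:E =
   \int[mu]_(v in V `\ vm) (limn (fun n => F n v)))%E.
  apply: eq_integral => v; rewrite inE => Vv.
  by apply/esym/cvg_lim => //; exact: Fcvg.
have Fmono v : V v -> nondecreasing_seq (F ^~ v).
  move=> Vv m n mn; rewrite lee_fin ler_pM ?mulr_ge0 ?M_ge0//.
  - by rewrite (le_trans ler01)// reduced_rate_ge1.
  - exact: reduced_rate_mono.
  rewrite ler_wpM2l ?M_ge0// /flight.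
  rewrite (@Rint_split _ 0 m.+1%:R n.+1%:R)//; last first.
  - exact: flight_integrable.
  - by rewrite ler_nat.
  by rewrite lerDl Rintegral_ge0// => s _; rewrite mulr_ge0// expR_ge0.
have mF n : measurable_fun (V `\ vm) (F n).
  have h := measurable_int mu (iF n).
  by apply: (measurable_funS mV _ h); exact: subDsetl.
have intF n : (\int[mu]_(v in V `\ vm) F n v = (T n (e_ l))%:E)%E.
  rewrite (@integral_setD1 _ (F n) vm)//.
  rewrite /T -RintegralZl//; last first.
    exact: (jump_integrable mV iM relative_speed_bound).
  by rewrite EFin_Rintegral//; exact: iF.
rewrite monotone_convergence//.
- apply: lime_le.
    apply: ereal_nondecreasing_is_cvgn => m n mn; apply: ge0_le_integral => //.
    + by move=> v [Vv _]; exact: F0.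
    + exact: mF.
    + exact: mF.
    + by move=> v [Vv _]; exact: Fmono.
  by apply: nearW => n; rewrite intF lee_fin.
- by move=> n v [Vv _]; exact: F0.
- by move=> v [Vv _] m n mn; exact: Fmono.
Qed.

End Tilt.

(** Continuity of an integral with respect to a parameter is available on open
    intervals; this extends [[0, 1]] to such an interval while keeping the tilt
    within its range. *)
Definition clamp (x : R) : R := pos x - pos (x - 1).

Lemma clamp_range x : 0 <= clamp x <= 1.
Proof.
rewrite /clamp; have [x0|x0] := lerP x 0.
  by rewrite !pos_eq0 ?subrr ?lexx ?ler01//; lra.
rewrite (pos_id (ltW x0)); have [x1|x1] := lerP x 1.
  by rewrite pos_eq0 ?subr0 ?(ltW x0)//; lra.
rewrite pos_id; last by lra.
by apply/andP; split; lra.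
Qed.

Lemma clamp_continuous : continuous clamp.
Proof.
apply: continuousDf; first exact: (continuous_pos (@continuous_idf R)).
apply: continuousNf; apply: continuous_pos.
by apply: continuousDf; [exact: continuous_idf|exact: continuous_cstf].
Qed.

Lemma clamp0 : clamp 0 = 0.
Proof. by rewrite /clamp !pos_eq0 ?subrr// sub0r oppr_le0. Qed.

Lemma clamp1 : clamp 1 = 1.
Proof. by rewrite /clamp subrr (pos_id ler01) pos_eq0 ?subr0. Qed.

(** Intermediate value theorem for the dispersion integral between tilt 0, where
    it equals [1 + r], and tilt [l], where it is at most 1.  Domination comes
    from [1 / ((1 - x) + x * kap) <= 1 + 1 / kap] for [0 <= x <= 1]. *)
Lemma dispersion_root l : 0 <= l -> (forall k, T k (e_ l) <= 1) ->
  exists lam : R, 0 < lam <= (vm - c)^-1 /\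
   ((1 + r)%:E * \int[mu]_(v in V) (M v / (1 + lam * (c - v)))%:E = 1%E)%E.
Proof.
move=> l0 Tl.
have vc0 : 0 < vm - c by rewrite subr_gt0.
have lrange := tilt_range l0 Tl.
have r10 : 0 < 1 + r by rewrite addr_gt0.
have mVm : measurable (V `\ vm) by exact: measurableD.
have sVm : V `\ vm `<=` V by exact: subDsetl.
pose f (x v : R) := M v / (1 - l * clamp x * (v - c)).
have mf x : measurable_fun V (f x) := measurable_profile (l * clamp x).
have mf' x : measurable_fun (V `\ vm) (f x).
  by apply: (measurable_funS mV _ (mf x)).
pose P v := M v / (1 - l * (v - c)).
have P0 v : V v -> 0 <= P v.
  by move=> Vv; rewrite divr_ge0 ?M_ge0// kappa_ge0.
have mP : measurable_fun V P by exact: measurable_profile.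
have lim := dispersion_integral_le1 l0 lrange Tl.
have iP : mu.-integrable V (EFin \o P).
  have -> : P = (fun v => (1 + r)^-1 * ((1 + r) * P v)).
    by apply/funext => v; rewrite mulKf// gt_eqF.
  apply: integrable_scale => //; apply/integrableP; split.
    by apply/measurable_EFinP; exact: measurable_funM.
  apply: (@le_lt_trans _ _ 1%E); last by rewrite ltry.
  apply: le_trans lim; rewrite le_eqVlt; apply/orP; left; apply/eqP.
  apply: eq_integral => v; rewrite inE => Vv /=.
  by rewrite ger0_norm// mulr_ge0 ?P0// ltW.
have fle x v : (V `\ vm) v -> `|f x v| <= M v + P v.
  move=> [Vv /eqP vvm]; have k0 := kappa_gt0 l0 lrange Vv vvm.
  have Mv := M_ge0 Vv.
  have /andP[t0 t1] := clamp_range x.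
  have d0 : 0 < 1 - l * clamp x * (v - c).
    have -> : 1 - l * clamp x * (v - c) = (1 - clamp x) + clamp x * (1 - l * (v - c)).
      by ring.
    move: t1; rewrite le_eqVlt => /predU1P[->|t1]; first by rewrite subrr add0r mul1r.
    by rewrite ltr_pwDl ?subr_gt0// mulr_ge0// ltW.
  rewrite ger0_norm /f /P; last by rewrite divr_ge0// ltW.
  have [kl|kl] := lerP 1 (1 - l * (v - c)).
    apply: (@le_trans _ _ (M v)); last by rewrite lerDl divr_ge0// ltW.
    rewrite ler_piMr// invf_le1//.
    have : l * (v - c) <= 0 by lra.
    nra.
  apply: (@le_trans _ _ (P v)); last by rewrite lerDr.
  rewrite ler_wpM2l// lef_pV2 ?posrE//.
  have : 0 <= l * (v - c) by lra.
  nra.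
have iMP : mu.-integrable (V `\ vm) (EFin \o (fun v => M v + P v)).
  have h := integrable_add mV iM iP.
  by apply: integrableS h.
have iF x : mu.-integrable (V `\ vm) (EFin \o f x).
  by apply: (integrable_le mVm (mf' x) _ iMP); exact: fle.
pose I x := \int[mu]_(v in V `\ vm) f x v.
have cI : {in `]-1, 2[%classic, continuous I}.
  apply: (@continuity_under_integral R _ _ mu f (V `\ vm) mVm (-1) 2 _ _
     (fun v => M v + P v)) => //.
  - apply: nearW => v [Vv /eqP vvm] x _.
    have k0 := kappa_gt0 l0 lrange Vv vvm.
    have /andP[t0 t1] := clamp_range x.
    have d0 : 0 < 1 - l * clamp x * (v - c).
      have -> : 1 - l * clamp x * (v - c) = (1 - clamp x) + clamp x * (1 - l * (v - c)).
        by ring.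
      move: t1; rewrite le_eqVlt => /predU1P[->|t1]; first by rewrite subrr add0r mul1r.
      by rewrite ltr_pwDl ?subr_gt0// mulr_ge0// ltW.
    apply: cvgM; first exact: cvg_cst.
    apply: cvgV; first by rewrite gt_eqF.
    apply: cvgB; first exact: cvg_cst.
    apply: cvgM; last exact: cvg_cst.
    by apply: cvgM; [exact: cvg_cst|exact: clamp_continuous].
  - by move=> x _; apply: nearW => v; exact: fle.
have I0 : I 0 = 1.
  rewrite /I.
  have -> : f 0 = M.
    by apply/funext => v; rewrite /f clamp0 mulr0 mul0r subr0 divr1.
  by rewrite Rintegral_setD1// /Rintegral M_mass.
have I1 : I 1 <= (1 + r)^-1.
  rewrite /I.
  have -> : f 1 = P.
    by apply/funext => v; rewrite /f clamp1 mulr1.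
  rewrite Rintegral_setD1//.
  rewrite -[leRHS]mul1r ler_pdivlMr// mulrC -RintegralZl//.
  rewrite -lee_fin EFin_Rintegral//; exact: integrable_scale.
have iv : (1 + r)^-1 <= 1 by rewrite invf_le1// lerDl ltW.
have [||x + Ix] := @IVT R I 0 1 (1 + r)^-1 ler01.
- apply: continuous_in_subspaceT => x; rewrite inE /= in_itv/= => /andP[x0 x1].
  by apply: cI; rewrite inE /= in_itv/=; apply/andP; split; lra.
- by rewrite ge_min I1 orbT /= le_max I0 iv.
rewrite in_itv/= => /andP[x0 x1].
have /andP[t0 t1] := clamp_range x.
have lt0 : 0 <= l * clamp x by rewrite mulr_ge0.
exists (l * clamp x); split.
  apply/andP; split.
    rewrite lt_neqAle lt0 andbT; apply/negP => /eqP lx0.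
    move: Ix; rewrite /I.
    have -> : f x = M.
      by apply/funext => v; rewrite /f -lx0 mul0r subr0 divr1.
    rewrite Rintegral_setD1// /Rintegral M_mass /= => /esym/eqP.
    rewrite invr_eq1 => /eqP; have := r_gt0; lra.
  apply: (@le_trans _ _ l); first by rewrite ler_piMr.
  by rewrite -[leRHS]mul1r ler_pdivlMr.
have -> : (\int[mu]_(v in V) (M v / (1 + l * clamp x * (c - v)))%:E =
   \int[mu]_(v in V `\ vm) (f x v)%:E)%E.
  rewrite (@integral_setD1 _ (fun v => (f x v)%:E) vm)//; last first.
    by apply/measurable_EFinP; exact: mf'.
  by apply: eq_integral => v _; rewrite /f; congr (_ / _)%:E; ring.
rewrite -EFin_Rintegral// -/(I x) Ix -EFinM mulfV// gt_eqF//.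
Qed.

(** If the exponential moment of [T n] were at most 1 for some tilt for every
    [n], then [c] would solve the dispersion relation although [c < cstar]. *)
Lemma subcritical_profile cstar : lbound (dispersion_speeds r V M) cstar ->
  c < cstar ->
  exists S b L phi0 B : R, exists phi : R -> R,
    [/\ 0 < S, 1 <= b < 1 + r, continuous phi, forall y, 0 <= phi y <= B &
     [/\ forall y, L <= `|y| -> phi y = 0,
         0 < phi0, forall y, `|y| <= W * S -> phi0 <= phi y &
         forall y, phi y <= b * J S (fun z => phi (y - z))]].
Proof.
move=> cstar_lb c_sub.
have [n sup_n] : exists n, forall lam, 0 <= lam -> 1 < T n (e_ lam).
  apply: contrapT => /forallNP none.
  have [|l l0 Tl] := common_tilt.
    move=> n; have /existsNP[lam] := none n.
    by move=> /not_implyP[lam0 /negP]; rewrite -leNgt; exists lam.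
  have [lam lamP] := dispersion_root l0 Tl.
  have : dispersion_speeds r V M c.
    by split; [rewrite (ltW c_gt0)|exists lam].
  by move=> /cstar_lb; rewrite leNgt c_sub.
have Tn_id : T n id < 0.
  rewrite /T nmulr_llt0; last exact: jump_id_lt0.
  by rewrite (lt_le_trans ltr01)// reduced_rate_ge1.
have [lam lam0 Tlam] := critical_tilt (@T_le n) (@T_add n) (@T_scale n) Tn_id (T_pos n).
have [phi [L [phi0 [B [cphi phiB phiL [phi00 phi0P] phiT]]]]] :=
  compact_subsolution (W_ge0 n) (@T_le n) (@T_add n) (@T_scale n) lam0 (T_pos n) Tlam
    (sup_n lam lam0).
exists n.+1%:R, (reduced_rate n), L, phi0, B, phi; split => //.
by rewrite reduced_rate_ge1 reduced_rate_lt.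
Qed.

End Speed.

(** As [1 / (1 - y) >= 1 + y] and the mean velocity is 0, the left-hand side of
    the dispersion relation at speed 0 is at least [1 + r]. *)
Lemma dispersion_speed_gt0 c : dispersion_speeds r V M c -> 0 < c.
Proof.
move=> [/andP[c0 cvm] [lam [/andP[lam0 lamv] disp]]].
rewrite lt_neqAle c0 andbT; apply/negP => /eqP c00.
move: cvm lamv disp; rewrite -c00 subr0 => vm0 lamv disp.
have r10 : 0 < 1 + r by rewrite addr_gt0.
have [_ vmax] := velocities_max.
have mVm : measurable (V `\ vm) by exact: measurableD.
have sVm : V `\ vm `<=` V by exact: subDsetl.
pose f v := M v / (1 - lam * (v - 0)).
have mf : measurable_fun V f by exact: measurable_profile.
have mf' : measurable_fun (V `\ vm) f by apply: (measurable_funS mV _ mf).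
have lv1 : lam * vm <= 1 by rewrite -ler_pdivlMr// mul1r.
have k0 v : V v -> v != vm -> 0 < 1 - lam * v.
  move=> Vv vvm; rewrite subr_gt0; apply: lt_le_trans lv1.
  by rewrite ltr_pM2l// lt_neqAle vvm vmax.
have ge : (1%:E <= \int[mu]_(v in V) (M v / (1 + lam * (0 - v)))%:E)%E.
  have i1 : mu.-integrable V (EFin \o (fun v => M v + lam * (M v * v))).
    apply: integrable_add => //; apply: integrable_scale => //.
    exact: momentum_integrable.
  have -> : (1%:E = \int[mu]_(v in V) (M v + lam * (M v * v))%:E)%E.
    rewrite -EFin_Rintegral// RintegralD//; last first.
      by apply: integrable_scale => //; exact: momentum_integrable.
    rewrite RintegralZl//; last exact: momentum_integrable.
    by rewrite mean_zero mulr0 addr0 /Rintegral M_mass.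
  have -> : (fun v => (M v / (1 + lam * (0 - v)))%:E) = EFin \o f.
    by apply/funext => v; rewrite /f/=; congr (_ / _)%:E; ring.
  rewrite -(@integral_setD1 _ _ vm)//; last first.
    apply: (measurable_funS mV sVm); exact: (measurable_int mu i1).
  rewrite -(@integral_setD1 _ (EFin \o f) vm)//; last exact/measurable_EFinP.
  apply: ge0_le_integral => //.
  - move=> v [Vv /eqP vvm]; rewrite lee_fin.
    have := velocities_bound Vv; rewrite ler_norml => /andP[vl _].
    have h : 0 <= 1 + lam * v.
      have : lam * - vm <= lam * v by rewrite ler_pM2l.
      by rewrite mulrN; lra.
    by have := mulr_ge0 (M_ge0 Vv) h; lra.
  - apply: (measurable_funS mV sVm); exact: (measurable_int mu i1).
  - exact/measurable_EFinP.
  - move=> v [Vv /eqP vvm]; rewrite lee_fin /f.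
    have kv := k0 v Vv vvm.
    rewrite subr0 ler_pdivlMr//.
    have := M_ge0 Vv; have := sqr_ge0 (lam * v) => h1 h2.
    have := mulr_ge0 h2 h1; rewrite expr2; lra.
have : ((1 + r)%:E * 1%:E <= 1%:E)%E.
  by rewrite -{2}disp lee_pmul2l// lte_fin.
rewrite mule1 lee_fin; have := r_gt0; lra.
Qed.

End Velocities.

(** * Spreading at the minimal speed *)

Section Limits.
Variable R : realType.

Lemma sup_cvg0 (f : R -> R -> R) (X : R -> set R) (bd : R -> R) :
  (forall t, X t !=set0) ->
  (forall t x, 0 <= t -> X t x -> 0 <= f t x <= bd t) ->
  bd t @[t --> +oo] --> (0 : R) ->
  sup [set f t x | x in X t] @[t --> +oo] --> (0 : R).
Proof.
move=> X0 fbd bd0.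
apply: (squeeze_cvgr _ (cvg_cst 0) bd0).
near=> t.
have t0 : 0 <= t by near: t; exact: nbhs_pinfty_ge.
have [x Xx] := X0 t.
have ub : ubound [set f t x | x in X t] (bd t).
  by move=> _ [y Xy <-]; have /andP[] := fbd t y t0 Xy.
apply/andP; split.
  have /andP[h _] := fbd t x t0 Xx; apply: le_trans h _.
  by apply: ub_le_sup; [exists (bd t)|exists x].
by apply: ge_sup => //; exists (f t x), x.
Unshelve. all: by end_near. Qed.

Lemma expRN_cvg0 (d : R) : 0 < d -> expR (- (d * t)) @[t --> +oo] --> (0 : R).
Proof.
move=> d0; apply: (cvg_comp (fun t => d * t) (fun y => expR (- y))).
  exact: gt0_cvgMry.
exact: cvgr_expR.
Qed.

Lemma mul_expRN_cvg0 (d : R) : 0 < d -> t * expR (- (d * t)) @[t --> +oo] --> (0 : R).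
Proof.
move=> d0.
have d2 : 0 < d / 2 by rewrite divr_gt0.
apply: (@squeeze_cvgr _ _ _ _ (fun=> 0) (fun t => (d / 2)^-1 * expR (- (d / 2 * t)))).
- near=> t.
  have t0 : 0 <= t by near: t; exact: nbhs_pinfty_ge.
  rewrite mulr_ge0 ?expR_ge0//=.
  have -> : - (d * t) = - (d / 2 * t) + - (d / 2 * t) by field.
  rewrite expRD mulrA ler_wpM2r ?expR_ge0//.
  rewrite expRN ler_pdivrMr ?expR_gt0// mulrC ler_pdivlMr//.
  by have := expR_ge1Dx (d / 2 * t); lra.
- exact: cvg_cst.
- rewrite -(mulr0 (d / 2)^-1); apply: cvgM; first exact: cvg_cst.
  exact: expRN_cvg0.
Unshelve. all: by end_near. Qed.

End Limits.

Unset Implicit Arguments.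

Theorem proposition1p6 (R : realType) (r : R) (V : set R) (M : R -> R)
    (g0 : R -> R -> R) (g : R -> R -> R -> R) (cstar : R)
    (r_gt0 : 0 < r)
    (V_compact : compact V)
    (V_sym : [set - v | v in V] = V)
    (V_supp : V = density_supp V M)
    (M_cont : {within V, continuous M})
    (M_ge0 : forall v, V v -> 0 <= M v)
    (M_mass : (\int[lebesgue_measure]_(v in V) (M v)%:E = 1%E)%E)
    (M_mean : (\int[lebesgue_measure]_(v in V) (v * M v)%:E = 0%E)%E)
    (M_var : (\int[lebesgue_measure]_(v in V) (v ^+ 2 * M v)%:E < +oo)%E)
    (M_inf : 0 < inf [set M v | v in V])
    (g0_meas : measurable_fun [set p : R * R | V p.2]
                 (fun p : R * R => g0 p.1 p.2))
    (g0_bound : forall x v, V v -> 0 <= g0 x v <= M v)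
    (g_sol : cauchy_solution r V M g0 g)
    (cstar_min : minimal_speed r V M cstar) :
  ((exists xR : R, forall x v, xR <= x -> V v -> g0 x v = 0) ->
   forall c : R, cstar < c -> forall v, V v ->
     sup [set g t x v | x in [set x | c * t <= x]] @[t --> +oo] --> (0 : R))
  /\
  ((exists xL gamma : R, 0 < gamma < 1 /\
      forall x v, x <= xL -> V v -> gamma * M v <= g0 x v) ->
   forall c : R, c < cstar -> forall v, V v ->
     sup [set `|M v - g t x v| | x in [set x | x <= c * t]] @[t --> +oo]
       --> (0 : R)).
Proof.
have mV : measurable V := velocities_measurable V_compact.
have mM : measurable_fun V M := density_measurable V_compact M_cont.
have r10 : 0 < 1 + r by rewrite addr_gt0.
have [disp cstar_lb] := cstar_min.
have cs_gt0 := dispersion_speed_gt0 r_gt0 V_compact V_sym M_cont M_ge0 M_mass M_mean disp.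
have [/andP[cs0 cs_lt] [lam [/andP[lam0 lamv] disp_eq]]] := disp.
have [Vm vmax] := velocities_max V_compact M_mass.
have iM := M_integrable mM M_ge0 M_mass.
split.
- move=> [xR g0R] c cs_c v Vv.
  have vc0 : 0 < sup V - cstar by rewrite subr_gt0.
  have lrange : lam * (sup V - cstar) <= 1 by rewrite -ler_pdivlMr// mul1r.
  pose kap w := 1 + lam * (cstar - w).
  have kE w : kap w = 1 - lam * (w - cstar) by rewrite /kap; ring.
  have kap_gt0 w : V w -> w != sup V -> 0 < kap w.
    move=> Vw wV; rewrite kE.
    exact: (kappa_gt0 V_compact M_mass (ltW lam0) lrange Vw wV).
  have kap_ge0 w : V w -> 0 <= kap w.
    move=> Vw; rewrite kE.
    exact: (kappa_ge0 V_compact M_mass (ltW lam0) lrange Vw).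
  have mP : measurable_fun V (fun w => M w / kap w).
    have -> : (fun w => M w / kap w) = (fun w => M w / (1 - lam * (w - cstar))).
      by apply/funext => w; rewrite kE.
    exact: measurable_profile.
  have P0 w : V w -> 0 <= M w / kap w.
    by move=> Vw; rewrite divr_ge0 ?M_ge0// kap_ge0.
  have iP : lebesgue_measure.-integrable V (EFin \o (fun w => M w / kap w)).
    apply/integrableP; split; first exact/measurable_EFinP.
    have -> : (\int[lebesgue_measure]_(w in V) `|(EFin \o (fun w => (M w / kap w)%R)) w| =
               \int[lebesgue_measure]_(w in V) (M w / (1 + lam * (cstar - w)))%:E)%E.
      by apply: eq_integral => w; rewrite inE => Vw; rewrite gee0_abs// lee_fin P0.
    move: disp_eq; set X := (\int[_]_(_ in _) _)%E.
    have : (0 <= X)%E by apply: integral_ge0 => w Vw; rewrite lee_fin P0.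
    case: X => [X _ _|_|]; [exact: ltry| |by []].
    by rewrite gt0_muley ?lte_fin.
  have iF := integrable_scale (1 + r) mV iP.
  have F_mass : \int[lebesgue_measure]_(w in V) ((1 + r) * (M w / kap w)) = 1.
    rewrite RintegralZl//; apply: EFin_inj.
    by rewrite EFinM EFin_Rintegral.
  have xRb : exists xR : R, forall x w, xR <= x -> V w -> g0 x w = 0 by exists xR.
  have vm0 : 0 < sup V by exact: lt_trans cs_lt.
  pose Q := 1 + lam * (cstar + sup V).
  have Q0 : 0 < Q by rewrite addr_gt0// mulr_gt0// addr_gt0.
  pose A := expR (lam * xR) * Q.
  have A0 : 0 <= A by rewrite mulr_ge0 ?expR_ge0// ltW.
  have g0_le x w : V w -> w != sup V ->
      g0 x w <= A * expR (- (lam * (x - cstar * 0))) * ((1 + r) * (M w / kap w)).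
    move=> Vw wV; have Mw := M_ge0 w Vw; have k0 := kap_gt0 w Vw wV.
    have Pw := P0 w Vw.
    have [xx|xx] := lerP xR x.
      rewrite g0R//; apply: mulr_ge0; apply: mulr_ge0 => //.
      exact: ltW.
    have /andP[_ g0M] := g0_bound x w Vw; apply: le_trans g0M _.
    have e1 : 1 <= expR (lam * xR) * expR (- (lam * (x - cstar * 0))).
      rewrite -expRD -expR0 ler_expR.
      have : lam * x <= lam * xR by rewrite ler_pM2l// ltW.
      lra.
    have kQ : kap w <= Q.
      have := velocities_bound V_compact V_sym M_mass Vw.
      rewrite ler_norml => /andP[wl _].
      by rewrite /kap /Q lerD2l ler_pM2l// lerD2l lerNl.
    have MQ : M w <= Q * (M w / kap w).
      by rewrite mulrCA ler_peMr// ler_pdivlMr// mul1r.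
    apply: (le_trans MQ).
    have -> : A * expR (- (lam * (x - cstar * 0))) * ((1 + r) * (M w / kap w)) =
      (expR (lam * xR) * expR (- (lam * (x - cstar * 0))) * (1 + r)) * (Q * (M w / kap w)).
      by rewrite /A; ring.
    rewrite ler_peMl//; first by rewrite mulr_ge0// ltW.
    rewrite -[leLHS]mulr1; apply: ler_pM => //.
    by rewrite lerDl ltW.
  have bound t x : 0 <= t -> g t x v <= expR (- t) * M v +
      (1 + r) * M v * A * (t * expR (- (lam * (x - cstar * t)))).
    move=> t0.
    have /andP[_ g0M] := g0_bound (x - v * t) v Vv.
    exact: (g_exp_bound r_gt0 mV mM M_ge0 M_mass g_sol A0 kap_gt0 iF F_mass g0_le
      kap_ge0 t0 Vv g0M).
  have Mv := M_ge0 v Vv.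
  apply: (@sup_cvg0 _ (fun t x => g t x v) (fun t => [set x | c * t <= x])
    (fun t => expR (- (1 * t)) * M v +
       (1 + r) * M v * A * (t * expR (- (lam * (c - cstar) * t))))).
  + by move=> t; exists (c * t) => /=.
  + move=> t x t0 /= xct; rewrite (g_ge0 g_sol)//=.
    apply: le_trans (bound t x t0) _; rewrite mul1r lerD2l.
    rewrite ler_wpM2l//.
      by apply: mulr_ge0 => //; apply: mulr_ge0 => //; exact: ltW.
    rewrite ler_wpM2l// ler_expR.
    have : lam * (c * t) <= lam * x by rewrite ler_pM2l.
    lra.
  + rewrite -[X in _ --> X]addr0; apply: cvgD.
      rewrite -(mul0r (M v)); apply: cvgM; last exact: cvg_cst.
      exact: expRN_cvg0.
    rewrite -(mulr0 ((1 + r) * M v * A)); apply: cvgM; first exact: cvg_cst.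
    by apply: mul_expRN_cvg0; rewrite mulr_gt0// subr_gt0.
- move=> [xL [gam [gam01 g0L]]] c c_cs v Vv.
  pose c1 := (Num.max c 0 + cstar) / 2.
  have mx : Num.max c 0 < cstar by rewrite gt_max c_cs cs_gt0.
  have c_c1 : c < c1.
    have : c <= Num.max c 0 by rewrite le_max lexx.
    by rewrite /c1; lra.
  have c1_gt0 : 0 < c1.
    have : 0 <= Num.max c 0 by rewrite le_max lexx orbT.
    by rewrite /c1; lra.
  have c1_lt : c1 < cstar by rewrite /c1; lra.
  have [S [b [L [phi0 [B [phi [S0 br cphi phiB [phiL phi00 core sub]]]]]]]] :=
    subcritical_profile r_gt0 V_compact V_sym V_supp M_cont M_ge0 M_mass M_mean
      c1_gt0 (lt_trans c1_lt cs_lt) cstar_lb c1_lt.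
  have Wb := relative_speed_bound V_compact V_sym M_mass c1_gt0.
  have g00 x w : V w -> 0 <= g0 x w by move=> Vw; have /andP[] := g0_bound x w Vw.
  have [eta [X0 [eta0 geta]]] :=
    invasion_lower_bound r_gt0 mV mM M_ge0 M_mass g_sol S0 br cphi phiB phiL
     phi00 core sub Wb gam01 g00 g0L.
  have [delta [m [d0 m0 rel]]] :=
    relaxation_lower_bound r_gt0 mV mM M_ge0 M_mass g_sol Wb eta0 g00 geta.
  apply: (@sup_cvg0 _ (fun t x => `|M v - g t x v|) (fun t => [set x | x <= c * t])
    (fun t => M v * (expR (- (delta * t))
       + 2 * expR (- (m * X0)) * expR (- (m * (c1 - c) * t))))).
  + by move=> t; exists (c * t) => /=.
  + move=> t x t0 /= xct; rewrite normr_ge0/=.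
    have gM : g t x v <= M v by exact: (g_leM g_sol).
    rewrite ger0_norm ?subr_ge0//.
    have := rel t x v t0 Vv.
    have : expR (m * (x - c1 * t - X0)) <= expR (- (m * X0)) * expR (- (m * (c1 - c) * t)).
      rewrite -expRD ler_expR.
      have : m * x <= m * (c * t) by rewrite ler_pM2l.
      lra.
    move=> h1 h2.
    have h3 : M v * expR (m * (x - c1 * t - X0)) <=
       M v * (expR (- (m * X0)) * expR (- (m * (c1 - c) * t))).
      by rewrite ler_wpM2l// M_ge0.
    lra.
  + rewrite -(mulr0 (M v)); apply: cvgM; first exact: cvg_cst.
    rewrite -[X in _ --> X]addr0; apply: cvgD; first exact: expRN_cvg0.
    rewrite -(mulr0 (2 * expR (- (m * X0)))); apply: cvgM; first exact: cvg_cst.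
    by apply: expRN_cvg0; rewrite mulr_gt0// subr_gt0.
Qed.
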